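(* Let $M$ and $\alpha$ be positive real parameters, $\Delta=r^2-2Mr-\alpha^2$, $\Xi=r^2-\alpha^2\cos^2\theta$, and consider the Euclidean Kerr space with the Euclidean (Riemannian) Kerr metric $$g_K=\Xi\left(\frac{dr^2}{\Delta}+d\theta^2\right)+\frac{\sin^2\theta}{\Xi}\left(\alpha\,dt+(r^2-\alpha^2)\,d\phi\right)^2+\frac{\Delta}{\Xi}\left(dt-\alpha\sin^2\theta\,d\phi\right)^2 ,$$ with orthonormal coframe $$e^1=\sqrt{\tfrac{\Xi}{\Delta}}\,dr,\quad e^2=\sqrt{\Xi}\,d\theta,\quad e^3=\tfrac{\sin\theta}{\sqrt{\Xi}}\left(\alpha\,dt+(r^2-\alpha^2)\,d\phi\right),\quad e^4=\sqrt{\tfrac{\Delta}{\Xi}}\left(dt-\alpha\sin^2\theta\,d\phi\right)$$ and orientation $e^1\wedge e^2\wedge e^3\wedge e^4$. Let $A=W^++\frac{R}{12}I$ be the $3\times3$ matrix with entries $$A_{ij}=\left(R_{0i0j}+\tfrac12\epsilon_{jkl}R_{0ikl}\right)+\tfrac12\epsilon_{imn}\left(R_{mn0j}+\epsilon_{jkl}R_{mnkl}\right).$$ Then $$A=W^++\frac{R}{12}I=\mathrm{diag}\left(-\frac{M}{(r-\alpha\cos\theta)^3},\ -\frac{M}{(r-\alpha\cos\theta)^3},\ \frac{2M}{(r-\alpha\cos\theta)^3}\right).$$ Since the space is Ricci-flat ($R_{\mu\nu}=0$, $R=0$), it is a 4-dimensional Einstein manifold with $A=W^+\neq0$, and the eigenvalues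 of $W^+$ are of the form $(\lambda,\lambda,-2\lambda)$, so that $W^+$ has at most two distinct eigenvalues at each point. The conformal factor $|W^+|^{2/3}$, which transforms the original manifold to a Kähler manifold, is $$|W^+|^{2/3}=\left(2\left(-\frac{M}{(r-\alpha\cos\theta)^3}\right)^2+\left(\frac{2M}{(r-\alpha\cos\theta)^3}\right)^2\right)^{1/3}=\frac{6^{1/3}M^{2/3}}{(r-\alpha\cos\theta)^2}.$$ It coincides up to a constant with the conformal factor $1/(r-\alpha\cos\theta)^2$ obtained from the exact Lee form $\xi=d\left(\log\left[C(r-\alpha\cos\theta)^2\right]\right)$ ($C$ an arbitrary constant, there taken to be $1$) of $g_K$ with respect to the almost complex structure $J$ given by $Je_1=e_4$, $Je_2=e_3$, $Je_3=-e_2$, $Je_4=-e_1$, where $(e_i)$ is the frame dual to $(e^i)$; the factor $|W^+|^{2/3}$ corresponds to $C=6^{-1/3}M^{-2/3}$.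
   Context: On an oriented Riemannian 4-manifold, let $\Lambda^2_\pm$ be the bundles of self-dual and anti-self-dual 2-forms, with bases $\Omega_\pm=\{e^1\wedge e^2\pm e^3\wedge e^4,\ e^1\wedge e^3\pm e^4\wedge e^2,\ e^1\wedge e^4\pm e^2\wedge e^3\}$. The Riemann curvature tensor defines a self-adjoint transformation of $\Lambda^2=\Lambda^2_+\oplus\Lambda^2_-$, a $6\times6$ block matrix with diagonal blocks $W^\pm+\frac{R}{12}I$ and off-diagonal blocks given by the trace-free Ricci curvature; $W^\pm$ are the self-dual and anti-self-dual parts of the Weyl tensor in matrix form and $R$ is the scalar curvature. The matrix $A$ represents the upper left block $W^++\frac{R}{12}I$. In the formula for $A_{ij}$, the $R_{abcd}$ are orthonormal-frame components of the Riemann tensor with indices running over $0,1,2,3$, where $i,j,k,l,m,n\in\{1,2,3\}$, repeated indices are summed, and $\epsilon$ is the totally antisymmetric symbol; the indices $0,1,2,3$ correspond to $e^1,e^2,e^3,e^4$. The norm is $|W^+|^2=\sum_{i=1}^3\lambda_i^2$ with $\lambda_i$ the eigenvalues of $W^+$. Derdziński's theorem: if $(M,g)$ is an oriented 4-dimensional Einstein manifold with $W^+$ non-vanishing, then $W^+$ has at each point at most two distinct eigenvalues on $\Lambda^2_+$ if and only if, up to a double cover, $|W^+|^{2/3}g$ is Kähler with respect to some complex structure compatible with the orientation. For a Hermitian structure $(g,J)$ with Kähler form $\omega(X,Y)=g(JX,Y)$ in real dimension 4, the Lee form is the 1-form $\xi$ with $d\omega=\xi\wedge\omega$; if $\xi=df$,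 the associated conformal factor is $e^{-f}$.
   Formalization: The formula for A_ij is corrected by a factor 1/2 overall and 1/2 on the last ε_jkl R_mnkl term (as displayed it gives (5/2)W⁺+(1/2)W⁻); the space is the chart r>M+√(M²+α²), 0<θ<π where the coframe is regular, and C>0. *)

(* Defs.v *)
(* MathComp / MathComp-Analysis, over an arbitrary R : realType. *)
From HB Require Import structures.
From mathcomp Require Import all_boot all_order all_algebra.
From mathcomp Require Import all_classical all_reals all_analysis.

Set Implicit Arguments.
Unset Strict Implicit.
Unset Printing Implicit Defensive.

Import Order.TTheory GRing.Theory Num.Theory.
Import numFieldNormedType.Exports.

Local Open Scope classical_set_scope.
Local Open Scope ring_scope.

(* Tensor fields on a domain of R^4 are given by their components in the
   coordinate basis; a point is a row vector of coordinates. *)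
Section Tensors.
Context {R : realType}.

Notation pt := 'rV[R]_4.
Notation scalar_field := (pt -> R).
Notation matrix_field := (pt -> 'M[R]_4).
Notation tensor4 := ('I_4 -> 'I_4 -> 'I_4 -> 'I_4 -> R).

Implicit Types (f : scalar_field) (g J : matrix_field) (p : pt).
Implicit Types (i j k l : 'I_4) (D : set pt).

Definition partial i f p : R := 'D_(delta_mx 0 i) f p.

Definition grad f p : 'rV[R]_4 := \row_i partial i f p.

Fixpoint of_class_C (n : nat) D f : Prop :=
  match n with
  | 0%N => forall p, D p -> {for p, continuous f}
  | m.+1 => (forall p, D p -> differentiable f p) /\
            forall i, of_class_C m D (partial i f)
  end.

Definition smooth_on D f : Prop := forall n, of_class_C n D f.

(** Curvature of a metric g (g p i j = g(d_i, d_j) at p). *)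

Definition christoffel g k i j p : R :=
  2^-1 * \sum_l invmx (g p) k l *
    (partial i (fun q => g q j l) p + partial j (fun q => g q i l) p
     - partial l (fun q => g q i j) p).

(* R^k_(l i j): the d_k-component of R(d_i, d_j) d_l, where
   R(X, Y) = nabla_X nabla_Y - nabla_Y nabla_X - nabla_[X, Y]. *)
Definition riemann_up g p k l i j : R :=
  partial i (christoffel g k j l) p - partial j (christoffel g k i l) p
  + \sum_m (christoffel g k i m p * christoffel g m j l p
            - christoffel g k j m p * christoffel g m i l p).

(* With this index order R_(k l k l) > 0 on the round sphere. *)
Definition riemann g p : tensor4 := fun k l i j =>
  \sum_m g p k m * riemann_up g p m l i j.

Definition ricci g p : 'M[R]_4 :=
  \matrix_(l, j) \sum_k riemann_up g p k l k j.

Definition scalar_curvature g p : R :=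
  \sum_l \sum_j invmx (g p) l j * ricci g p l j.

(* Dimension 4: the coefficients are 1/(n-2) and 1/((n-1)(n-2)). *)
Definition weyl g p : tensor4 := fun k l i j =>
  riemann g p k l i j
  - 2^-1 * (g p k i * ricci g p l j - g p k j * ricci g p l i
            - g p l i * ricci g p k j + g p l j * ricci g p k i)
  + 6^-1 * scalar_curvature g p * (g p k i * g p l j - g p k j * g p l i).

Definition is_riemannian D g : Prop :=
  [/\ forall i j, smooth_on D (fun p => g p i j),
      forall p, D p -> (g p)^T = g p
    & forall p (v : 'rV[R]_4), D p -> v != 0 -> 0 < (v *m g p *m v^T) 0 0].

Definition is_einstein D g : Prop :=
  exists c : R, forall p, D p -> ricci g p = c *: g p.

(** Frames. Row a of [theta] is the a-th coframe 1-form; column a of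
    [dual_frame theta] is the a-th vector of the dual frame.  The frame
    indices 0, 1, 2, 3 stand for e^1, e^2, e^3, e^4. *)

Definition dual_frame (theta : 'M[R]_4) : 'M[R]_4 := invmx theta.

Definition is_orthonormal_coframe (gp theta : 'M[R]_4) : Prop :=
  theta \in unitmx /\ gp = theta^T *m theta.

Definition frame_components (theta : 'M[R]_4) (T : tensor4) : tensor4 :=
  let E := dual_frame theta in
  fun a b c d => \sum_k \sum_l \sum_i \sum_j
    T k l i j * E k a * E l b * E i c * E j d.

(** Lambda^2 in an orthonormal frame: a 2-form is the antisymmetric matrix of
    its frame components. *)

Definition wedge2 (a b : 'I_4) : 'M[R]_4 := delta_mx a b - delta_mx b a.

(* s = 1: basis of Lambda^2_+ ; s = -1: basis of Lambda^2_-. *)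
Definition Omega (s : R) (i : 'I_3) : 'M[R]_4 :=
  nth 0 [:: wedge2 0 1 + s *: wedge2 2 3;
            wedge2 0 2 + s *: wedge2 3 1;
            wedge2 0 3 + s *: wedge2 1 2] i.

Definition Lambda2_basis (i : 'I_(3 + 3)) : 'M[R]_4 :=
  match fintype.split i with inl a => Omega 1 a | inr a => Omega (-1) a end.

(* Inner product for which the e^a /\ e^b (a < b) are orthonormal. *)
Definition inner2 (eta zeta : 'M[R]_4) : R :=
  2^-1 * \sum_a \sum_b eta a b * zeta a b.

(* e^a /\ e^b |-> 1/2 T_(a b c d) e^c /\ e^d, which is the identity for the
   Riemann tensor of the unit sphere. *)
Definition Lambda2_op (T : tensor4) (eta : 'M[R]_4) : 'M[R]_4 :=
  \matrix_(c, d) (2^-1 * \sum_a \sum_b eta a b * T a b c d).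

(* The basis is orthogonal, so these are the coefficients of the images of the
   basis vectors. *)
Definition Lambda2_mx (T : tensor4) : 'M[R]_(3 + 3) :=
  \matrix_(i, j) (inner2 (Lambda2_op T (Lambda2_basis i)) (Lambda2_basis j)
                  / inner2 (Lambda2_basis j) (Lambda2_basis j)).

Definition curvature_mx g (theta : matrix_field) p : 'M[R]_(3 + 3) :=
  Lambda2_mx (frame_components (theta p) (riemann g p)).

Definition Wplus g (theta : matrix_field) p : 'M[R]_3 :=
  ulsubmx (Lambda2_mx (frame_components (theta p) (weyl g p))).

(* The Levi-Civita symbol; addition in 'I_3 is modulo 3. *)
Definition eps (i j k : 'I_3) : R :=
  if (j == i + 1) && (k == j + 1) then 1
  else if (i == j + 1) && (j == k + 1) then -1
  else 0.

(* The self-dual block in terms of frame components, 'I_3 standing for the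
   frame indices 1, 2, 3.  The factors 1/2 in front of the whole sum and of
   the last epsilon are those for which this is the matrix of the curvature
   operator in the basis Omega_+ . *)
Definition Amx g (theta : matrix_field) p : 'M[R]_3 :=
  let Rm := frame_components (theta p) (riemann g p) in
  let s (i : 'I_3) : 'I_4 := lift ord0 i in
  \matrix_(i, j)
    (2^-1 *
     ((Rm 0 (s i) 0 (s j)
       + 2^-1 * \sum_k \sum_l eps j k l * Rm 0 (s i) (s k) (s l))
      + 2^-1 * \sum_m \sum_n eps i m n *
          (Rm (s m) (s n) 0 (s j)
           + 2^-1 * \sum_k \sum_l eps j k l * Rm (s m) (s n) (s k) (s l)))).

(** Eigenvalues and the norm |A|^2 = sum of the squared eigenvalues. *)

(* The eigenvalues with multiplicity, in some order, when the characteristic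
   polynomial splits over R (always so for the symmetric matrix W^+);
   the empty sequence otherwise. *)
Definition eigenvalues n (A : 'M[R]_n) : seq R :=
  xget [::] [set s : seq R | char_poly A = \prod_(x <- s) ('X - x%:P)].

Definition eigen_norm n (A : 'M[R]_n) : R :=
  Num.sqrt (\sum_(x <- eigenvalues A) x ^+ 2).

(** Hermitian and Kaehler structures: J d_i = sum_k (J p k i) d_k. *)

Definition nijenhuis J p k i j : R :=
  \sum_l (J p l i * partial l (fun q => J q k j) p
          - J p l j * partial l (fun q => J q k i) p
          - J p k l * (partial i (fun q => J q l j) p
                       - partial j (fun q => J q l i) p)).

Definition is_hermitian D g J : Prop :=
  [/\ is_riemannian D g,
      forall i j, smooth_on D (fun p => J p i j),
      forall p, D p -> J p *m J p = - 1%:M,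
      forall p, D p -> (J p)^T *m g p *m J p = g p
    & forall p, D p -> forall k i j, nijenhuis J p k i j = 0].

(* omega(X, Y) = g(J X, Y) *)
Definition kahler_form g J : matrix_field := fun p => (J p)^T *m g p.

Definition ext_d2 (omega : matrix_field) p i j k : R :=
  partial i (fun q => omega q j k) p + partial j (fun q => omega q k i) p
  + partial k (fun q => omega q i j) p.

Definition wedge12 (xi : 'rV[R]_4) (om : 'M[R]_4) i j k : R :=
  xi 0 i * om j k + xi 0 j * om k i + xi 0 k * om i j.

Definition is_kahler D g J : Prop :=
  is_hermitian D g J /\
  forall p, D p -> forall i j k, ext_d2 (kahler_form g J) p i j k = 0.

(* xi is the value at p of the Lee form: d omega = xi /\ omega at p. *)
Definition is_lee_form_at g J p (xi : 'rV[R]_4) : Prop :=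
  forall i j k, ext_d2 (kahler_form g J) p i j k
                = wedge12 xi (kahler_form g J p) i j k.

End Tensors.

(* Coordinates (r, theta, t, phi). *)
Section EuclideanKerr.
Context {R : realType}.
Variables M alpha : R.
Implicit Types p : 'rV[R]_4.

Definition crd_r p : R := p 0 0.
Definition crd_theta p : R := p 0 1.

Definition d_r : 'rV[R]_4 := delta_mx 0 0.
Definition d_theta : 'rV[R]_4 := delta_mx 0 1.
Definition d_t : 'rV[R]_4 := delta_mx 0 2.
Definition d_phi : 'rV[R]_4 := delta_mx 0 3.

(* The region outside the larger root of Delta and off the axis, where the
   coordinates and the coframe are regular; there Delta, Xi, sin theta and
   r - alpha cos theta are positive. *)
Definition kerr_domain : set 'rV[R]_4 :=
  [set p | M + Num.sqrt (M ^+ 2 + alpha ^+ 2) < crd_r p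
           /\ 0 < crd_theta p < pi].

Definition Delta p : R := crd_r p ^+ 2 - 2 * M * crd_r p - alpha ^+ 2.

Definition Xi p : R := crd_r p ^+ 2 - alpha ^+ 2 * cos (crd_theta p) ^+ 2.

Definition sigma_form p : 'rV[R]_4 :=
  alpha *: d_t + (crd_r p ^+ 2 - alpha ^+ 2) *: d_phi.

Definition tau_form p : 'rV[R]_4 :=
  d_t - (alpha * sin (crd_theta p) ^+ 2) *: d_phi.

Definition sqr_form (v : 'rV[R]_4) : 'M[R]_4 := v^T *m v.

Definition kerr_metric p : 'M[R]_4 :=
  Xi p *: ((Delta p)^-1 *: sqr_form d_r + sqr_form d_theta)
  + (sin (crd_theta p) ^+ 2 / Xi p) *: sqr_form (sigma_form p)
  + (Delta p / Xi p) *: sqr_form (tau_form p).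

Definition kerr_coframe p : 'M[R]_4 :=
  \matrix_(a < 4)
    nth 0 [:: Num.sqrt (Xi p / Delta p) *: d_r;
              Num.sqrt (Xi p) *: d_theta;
              (sin (crd_theta p) / Num.sqrt (Xi p)) *: sigma_form p;
              Num.sqrt (Delta p / Xi p) *: tau_form p] a.

(* Column b holds the coefficients of J e_b: in 1-based frame indices,
   J e_1 = e_4, J e_2 = e_3, J e_3 = - e_2, J e_4 = - e_1. *)
Definition J_frame : 'M[R]_4 :=
  delta_mx 3 0 + delta_mx 2 1 - delta_mx 1 2 - delta_mx 0 3.

Definition kerr_J p : 'M[R]_4 :=
  dual_frame (kerr_coframe p) *m J_frame *m kerr_coframe p.

Definition kerr_Wplus p : 'M[R]_3 := Wplus kerr_metric kerr_coframe p.

Definition rho p : R := crd_r p - alpha * cos (crd_theta p).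

(* |W^+|^(2/3) *)
Definition kerr_conf p : R := eigen_norm (kerr_Wplus p) `^ (2 / 3).

(* f with xi = df; the associated conformal factor is e^(-f). *)
Definition lee_potential (C : R) p : R := ln (C * rho p ^+ 2).

End EuclideanKerr.

(* Main.v *)
(** The orthonormal coframe admits antisymmetric connection 1-forms [omega] solving
    Cartan's first structure equation [d theta + omega /\ theta = 0]; metric
    compatibility and vanishing torsion identify them with the Levi-Civita connection,
    and the second structure equation expresses the Riemann tensor as
    [E (d omega + omega /\ omega) theta].  In this frame the only curvature components
    are [A], [-2A], [B], [-2B] up to sign, with
    [A + B = - M / (r - alpha cos theta)^3], from which the statements about Ricci,
    [W^+] and its norm follow by linear algebra.

    Every component that occurs is a polynomial in [M], [alpha], [r], [cos theta],
    [sin theta], [1 / sqrt Xi], [1 / sqrt Delta] and [1 / sin theta], and this ring is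
    closed under partial derivatives.  Smoothness is therefore immediate, and the
    structure equations, the integrability of [J], the equation [d om = xi /\ om] and the
    closedness of the rescaled Kaehler form are decided by normalization modulo a
    Groebner basis of the relations between these functions. *)

Require Import Defs.
From HB Require Import structures.
From Stdlib Require Import ZArith.
From mathcomp Require Import all_boot all_order all_algebra.
From mathcomp Require Import all_classical all_reals all_analysis.
From mathcomp Require Import ssrZ ring lra.

Set Implicit Arguments.
Unset Strict Implicit.
Unset Printing Implicit Defensive.

Import Order.TTheory GRing.Theory Num.Theory.
Import numFieldNormedType.Exports.

Local Open Scope classical_set_scope.
Local Open Scope ring_scope.

(** * Sparse polynomials with integer coefficients *)

(* A monomial is the sorted list of its variables, repeated according to
   multiplicity. *)
Definition monomial := seq nat.
Definition spoly := seq (monomial * Z).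

Definition pconst (z : int) : spoly := [:: ([::], Z_of_int z)].
Definition pvar (v : nat) : spoly := [:: ([:: v], Z.one)].
Definition padd (p q : spoly) : spoly := p ++ q.
Definition pmul (p q : spoly) : spoly :=
  [seq (merge leq t.1 u.1, Z.mul t.2 u.2) | t <- p, u <- q].
Definition pneg (p : spoly) : spoly := pmul (pconst (-1)) p.
Definition psub (p q : spoly) : spoly := padd p (pneg q).
Definition psum4 (f : nat -> spoly) : spoly := flatten [seq f k | k <- iota 0 4].

(* [dx v] is the derivative of the variable [v]. *)
Fixpoint mderiv (dx : nat -> spoly) (m : monomial) : spoly :=
  if m is v :: m' then
    padd (pmul [:: (m', Z.one)] (dx v)) (pmul (pvar v) (mderiv dx m'))
  else [::].
Definition pderiv (dx : nat -> spoly) (p : spoly) : spoly :=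
  flatten [seq pmul [:: ([::], t.2)] (mderiv dx t.1) | t <- p].

Fixpoint mlex (m n : monomial) : bool :=
  match m, n with
  | [::], _ => true
  | _, [::] => false
  | x :: m', y :: n' => (x < y)%N || ((x == y) && mlex m' n')
  end.

(** Only neighbours are merged, so complete cancellation needs a sorted list; the value is preserved
    on any list. *)
Fixpoint collect (p : spoly) : spoly :=
  if p is t :: p' then
    match collect p' with
    | u :: r =>
        if t.1 == u.1 then
          let z := Z.add t.2 u.2 in
          if Z.eqb z 0 then r else (t.1, z) :: r
        else t :: u :: r
    | [::] => if Z.eqb t.2 0 then [::] else [:: t]
    end
  else [::].

Definition sort_collect (p : spoly) : spoly :=
  collect (sort (fun t u => mlex t.1 u.1) p).

Definition reducible (rules : seq (monomial * spoly)) (t : monomial * Z) : bool :=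
  has (fun l => subseq l.1 t.1) rules.

(** The comparison with [merge leq l q] certifies the factorization: if it fails, the term is left
    as it is, so soundness does not rest on monomials being sorted. *)
Fixpoint reduce_term (rules : seq (monomial * spoly)) (t : monomial * Z) : spoly :=
  if rules is (l, rhs) :: rules' then
    if subseq l t.1 then
      let q := foldl (fun m v => rem v m) t.1 l in
      if merge leq l q == t.1 then pmul [:: (q, t.2)] rhs else [:: t]
    else reduce_term rules' t
  else [:: t].

(** Irreducible terms are set aside at once; only the freshly rewritten ones are sorted and
    collected again. [n] bounds the number of passes. *)
Fixpoint reduce_rec (rules : seq (monomial * spoly)) (n : nat) (p : spoly) : spoly :=
  if n is n'.+1 then
    if has (reducible rules) p then
      [seq t <- p | ~~ reducible rules t]
      ++ reduce_rec rules n' (sort_collect (flatten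
           [seq reduce_term rules t | t <- [seq t <- p | reducible rules t]]))
    else p
  else p.

Definition reduce rules n p := sort_collect (reduce_rec rules n (sort_collect p)).

(** * Evaluation, and soundness of the normalization *)

Section Eval.
Context {R : realType}.
Implicit Types (x : nat -> R) (p q : spoly).

Definition zval (z : Z) : R := (int_of_Z z)%:~R.
Definition meval x (m : monomial) : R := \prod_(v <- m) x v.
Definition eval x p : R := \sum_(t <- p) zval t.2 * meval x t.1.

Lemma zvalD a b : zval (Z.add a b) = zval a + zval b.
Proof. by rewrite /zval -[Z.add a b]/(a + b) rmorphD/= rmorphD. Qed.

Lemma zvalM a b : zval (Z.mul a b) = zval a * zval b.
Proof. by rewrite /zval -[Z.mul a b]/(a * b) rmorphM/= rmorphM. Qed.

Lemma zval0 : zval Z0 = 0. Proof. by []. Qed.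
Lemma zval1 : zval Z.one = 1. Proof. by []. Qed.

Lemma eval0 x : eval x [::] = 0. Proof. by rewrite /eval big_nil. Qed.

Lemma eval_cons x t p : eval x (t :: p) = zval t.2 * meval x t.1 + eval x p.
Proof. by rewrite /eval big_cons. Qed.

Lemma evalD x p q : eval x (padd p q) = eval x p + eval x q.
Proof. by rewrite /eval big_cat. Qed.

Lemma eval_flatten x (s : seq spoly) : eval x (flatten s) = \sum_(p <- s) eval x p.
Proof. by rewrite /eval big_flatten. Qed.

Lemma meval_merge x m n : meval x (merge leq m n) = meval x m * meval x n.
Proof.
by rewrite /meval -big_cat; apply: perm_big; rewrite perm_merge.
Qed.

Lemma evalM x p q : eval x (pmul p q) = eval x p * eval x q.
Proof.
rewrite /eval big_allpairs_dep mulr_suml; apply: eq_bigr => t _.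
rewrite mulr_sumr; apply: eq_bigr => u _ /=.
by rewrite zvalM meval_merge mulrACA.
Qed.

Lemma eval_const x z : eval x (pconst z) = z%:~R.
Proof. by rewrite eval_cons eval0 /meval big_nil mulr1 addr0 /zval /= Z_of_intK. Qed.

Lemma eval_var x v : eval x (pvar v) = x v.
Proof. by rewrite eval_cons eval0 /meval big_seq1 mul1r addr0. Qed.

Lemma evalN x p : eval x (pneg p) = - eval x p.
Proof. by rewrite evalM eval_const rmorphN1 mulN1r. Qed.

Lemma evalB x p q : eval x (psub p q) = eval x p - eval x q.
Proof. by rewrite evalD evalN. Qed.

Lemma eval_psum4 x f : eval x (psum4 f) = \sum_(k < 4) eval x (f k).
Proof. by rewrite /psum4 eval_flatten big_map -[iota 0 4]/(index_iota 0 4) big_mkord. Qed.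

Lemma eval_collect x p : eval x (collect p) = eval x p.
Proof.
elim: p => //= t p IH; rewrite eval_cons -IH.
case: (collect p) => [|u r].
  by case: Z.eqb_spec => [->|_]; rewrite ?eval_cons ?eval0 ?zval0 ?mul0r ?addr0.
case: eqP => [tu|_]; last by rewrite eval_cons.
case: Z.eqb_spec => [z0|_]; rewrite !eval_cons /= addrA tu -mulrDl -zvalD//.
by rewrite z0 zval0 mul0r add0r.
Qed.

(** Soundness needs only that each rule is a true equation at [x]; confluence and the number of
    passes merely decide whether a zero is recognized. *)
Definition valid_rules x (rules : seq (monomial * spoly)) :=
  forall l, l \in rules -> meval x l.1 = eval x l.2.

Lemma eval_reduce_term x rules t : valid_rules x rules ->
  eval x (reduce_term rules t) = zval t.2 * meval x t.1.
Proof.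
elim: rules => [|[l rhs] rules IH] v /=; first by rewrite eval_cons eval0 addr0.
case: ifP => _; last first.
  by apply: IH => l' ?; apply: v; rewrite inE orbC; apply/orP; left.
case: eqP => [E|_]; last by rewrite eval_cons eval0 addr0.
rewrite evalM eval_cons eval0 addr0 /= -[in RHS]E meval_merge.
have /= -> := v (l, rhs) (mem_head _ _).
by rewrite -mulrA [meval _ _ * _]mulrC.
Qed.

Lemma eval_sort_collect x p : eval x (sort_collect p) = eval x p.
Proof. by rewrite eval_collect; apply: perm_big; rewrite perm_sort. Qed.

Lemma eval_reduce x rules n p : valid_rules x rules ->
  eval x (reduce rules n p) = eval x p.
Proof.
move=> v; rewrite eval_sort_collect -[RHS]eval_sort_collect.
elim: n (sort_collect p) => //= n IH {}p; case: ifP => // _.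
rewrite evalD IH eval_sort_collect eval_flatten big_map.
under eq_bigr do rewrite eval_reduce_term//.
by rewrite /eval !big_filter [RHS](bigID (reducible rules))/= addrC.
Qed.

(** Serves the directions t and phi, along which every variable is constant. *)
Lemma eval_pderiv0 x dx p : (forall v, dx v = [::]) -> eval x (pderiv dx p) = 0.
Proof.
move=> dx0; rewrite /pderiv eval_flatten big_map big1// => t _.
rewrite evalM; have -> : eval x (mderiv dx t.1) = 0; last by rewrite mulr0.
elim: t.1 => [|v m IH]; rewrite /= ?eval0// evalD !evalM IH dx0 eval0.
by rewrite !mulr0 addr0.
Qed.

Definition evalE := (eval0, eval_const, eval_var, evalN, evalD, evalB, evalM).

End Eval.

Definition tab2 (f : nat -> nat -> spoly) := mkseq (fun i => mkseq (f i) 4) 4.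

Definition at2 t (i j : nat) : spoly := nth [::] (nth [::] t i) j.
Definition at3 t (i j k : nat) : spoly := at2 (nth [::] t i) j k.

Lemma at2_tab f (i j : 'I_4) : at2 (tab2 f) i j = f i j.
Proof. by rewrite /at2 !nth_mkseq. Qed.

(** A family of identities becomes one boolean that the kernel computes. Families with fewer than
    three indices go through the same test with dummy arguments. *)
Definition nil3 (nf : spoly -> spoly) (f : nat -> nat -> nat -> spoly) : bool :=
  all (fun i => all (fun j => all (fun k => nilp (nf (f i j k)))
    (iota 0 4)) (iota 0 4)) (iota 0 4).

Lemma nil3P nf f : nil3 nf f -> forall i j k : 'I_4, nf (f i j k) = [::].
Proof.
have m (n : 'I_4) : nat_of_ord n \in iota 0 4 by rewrite mem_iota ltn_ord.
by move=> + i j k => /allP/(_ _ (m i))/allP/(_ _ (m j))/allP/(_ _ (m k))/nilP.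
Qed.

(** * The ring of functions of the Kerr geometry *)

(* [pY], [pZ], [pS] stand for [1 / sqrt Xi], [1 / sqrt Delta], [1 / sin theta], and
   [pK] for a constant. *)
Definition pM := pvar 0.
Definition pa := pvar 1.
Definition pr := pvar 2.
Definition pc := pvar 3.
Definition ps := pvar 4.
Definition pY := pvar 5.
Definition pZ := pvar 6.
Definition pS := pvar 7.
Definition pK := pvar 8.

Arguments padd : simpl never.
Arguments pmul : simpl never.
Arguments pneg : simpl never.
Arguments psub : simpl never.
Arguments pconst : simpl never.
Arguments pvar : simpl never.
Arguments psum4 : simpl never.
Arguments pderiv : simpl never.

Declare Scope spoly_scope.
Delimit Scope spoly_scope with spoly.
Bind Scope spoly_scope with spoly.
Notation "p + q" := (padd p q) : spoly_scope.
Notation "- p" := (pneg p) : spoly_scope.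
Notation "p - q" := (psub p q) : spoly_scope.
Notation "p * q" := (pmul p q) : spoly_scope.
Notation "z %:P" := (pconst z) : spoly_scope.

(* A Groebner basis: the first two rules, the fourth and the fifth are the defining
   relations of [sin theta] and of the three inverses; the others are S-polynomials.
   Oriented in this way the rules terminate and are confluent. *)
Definition kerr_rules : seq (monomial * spoly) := ([::
  ([:: 4; 4], 1%:P - pc * pc);
  ([:: 4; 7], 1%:P);
  ([:: 3; 3; 7], pS - ps);
  ([:: 1; 1; 3; 3; 5; 5], pr * pr * pY * pY - 1%:P);
  ([:: 2; 2; 6; 6], 2%:P * pM * pr * pZ * pZ + pa * pa * pZ * pZ + 1%:P);
  ([:: 2; 2; 5; 5; 7],
     pS + pa * pa * pY * pY * pS - pa * pa * pY * pY * ps);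
  ([:: 1; 1; 5; 5; 6; 6],
     pS * pS * pZ * pZ - pS * pS * pY * pY
     - 2%:P * pM * pr * pY * pY * pZ * pZ * pS * pS)])%spoly.

Definition knf := reduce kerr_rules 30.

(** Chain rule with d_r Xi = 2 r, d_r Delta = 2 (r - M) and d_theta Xi = 2 alpha^2 cos theta sin
    theta; the factor 2 cancels the 1/2 of the inverse square root. *)
Definition kerr_dr (v : nat) : spoly := nth [::] [:: [::]; [::]; 1%:P; [::]; [::];
  - pr * pY * pY * pY; - (pr - pM) * pZ * pZ * pZ; [::]; [::]]%spoly v.
Definition kerr_dtheta (v : nat) : spoly := nth [::] [:: [::]; [::]; [::]; - ps; pc;
  - pa * pa * pc * ps * pY * pY * pY; [::]; - pc * pS * pS; [::]]%spoly v.
Definition kerr_d (i : nat) : nat -> spoly :=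
  nth (fun=> [::]) [:: kerr_dr; kerr_dtheta] i.

(** * Coframe, connection and curvature as tables of polynomials *)

Definition pXi : spoly := (pr * pr - pa * pa * pc * pc)%spoly.
Definition pDelta : spoly := (pr * pr - 2%:P * pM * pr - pa * pa)%spoly.

(** The ring contains only the inverse roots, so sqrt Xi is written Xi / sqrt Xi, and likewise for
    Delta. *)
Definition coframe_poly : seq (seq spoly) := [::
  [:: pXi * pY * pZ; [::]; [::]; [::]];
  [:: [::]; pXi * pY; [::]; [::]];
  [:: [::]; [::]; ps * pY * pa; ps * pY * (pr * pr - pa * pa)];
  [:: [::]; [::]; pDelta * pZ * pY; - pDelta * pZ * pY * pa * ps * ps]]%spoly.

(** The columns are the dual vectors; the last two are (alpha sin theta d_t + d_phi / sin theta) /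
    sqrt Xi and ((r^2 - alpha^2) d_t - alpha d_phi) / sqrt (Xi Delta). *)
Definition frame_poly : seq (seq spoly) := [::
  [:: pDelta * pZ * pY; [::]; [::]; [::]];
  [:: [::]; pY; [::]; [::]];
  [:: [::]; [::]; pa * ps * pY; pZ * pY * (pr * pr - pa * pa)];
  [:: [::]; [::]; pS * pY; - pZ * pY * pa]]%spoly.

Definition J_poly : seq (seq spoly) := [::
  [:: [::]; [::]; [::]; (-1)%:P]; [:: [::]; [::]; (-1)%:P; [::]];
  [:: [::]; 1%:P; [::]; [::]]; [:: 1%:P; [::]; [::]; [::]]]%spoly.

Definition mulmx_poly (A B : seq (seq spoly)) :=
  tab2 (fun i j => knf (psum4 (fun k => at2 A i k * at2 B k j)))%spoly.

Definition trmx_poly (A : seq (seq spoly)) := tab2 (fun i j => at2 A j i).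

(* [pL = sqrt Delta] *)
Definition pL : spoly := (pDelta * pZ)%spoly.
Definition pY2 : spoly := (pY * pY)%spoly.
(** The r-derivative of M r / Xi, that is -1/2 times the r-derivative of g(d_t, d_t) = 1 - 2 M r /
    Xi. *)
Definition pm : spoly := (pM * pY2 * (1%:P - 2%:P * pr * pr * pY2))%spoly.

Definition bivector (u01 u02 u03 u12 u13 u23 : spoly) : seq (seq spoly) :=
  [:: [:: [::]; u01; u02; u03]; [:: - u01; [::]; u12; u13];
      [:: - u02; - u12; [::]; u23]; [:: - u03; - u13; - u23; [::]]]%spoly.

(** The outer index is the coordinate direction i; entry (a, b) of that matrix is omega_ab(d_i),
    with a and b frame indices. *)
Definition connection_poly : seq (seq (seq spoly)) := [::
  bivector (pa * pa * pc * ps * pY2 * pZ) [::] [::] [::] [::] (pa * pr * ps * pY2 * pZ);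
  bivector (- pr * pL * pY2) [::] [::] [::] [::] (- pa * pc * pL * pY2);
  bivector [::] [::] pm ((-2)%:P * pM * pa * pr * pc * pY2 * pY2) [::] [::];
  bivector [::] (- pr * ps * pL * pY2) (pa * ps * ps * (pr * pY2 - pm))
    (- pc * pY2 * (pDelta + 2%:P * pM * pr * (pr * pr - pa * pa) * pY2))
    (pa * pc * ps * pL * pY2) [::]]%spoly.

(** [pA] and [pB] are the half sum and the half difference of -M / (r - alpha cos theta)^3 and -M /
    (r + alpha cos theta)^3, expanded over Xi^3. *)
Definition pA : spoly := (pM * pr * (3%:P - 4%:P * pr * pr * pY2) * pY2 * pY2)%spoly.
Definition pB : spoly := (pM * pa * pc * (1%:P - 4%:P * pr * pr * pY2) * pY2 * pY2)%spoly.

Definition curvature_poly : seq (seq (seq (seq spoly))) :=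
  let R01 := bivector pA [::] [::] [::] [::] pB in
  let R02 := bivector [::] pA [::] [::] (- pB) [::] in
  let R03 := bivector [::] [::] ((-2)%:P * pA) ((-2)%:P * pB) [::] [::] in
  let R12 := bivector [::] [::] ((-2)%:P * pB) ((-2)%:P * pA) [::] [::] in
  let R13 := bivector [::] (- pB) [::] [::] pA [::] in
  let R23 := bivector pB [::] [::] [::] [::] pA in
  let neg := map (map pneg) in
  [:: [:: [::]; R01; R02; R03]; [:: neg R01; [::]; R12; R13];
      [:: neg R02; neg R12; [::]; R23]; [:: neg R03; neg R13; neg R23; [::]]]%spoly.

Definition at4 t (i j k l : nat) : spoly := at3 (nth [::] t i) j k l.

(** * Cartan's structure equations *)

Definition torsion_poly (i j a : nat) : spoly :=
  (pderiv (kerr_d i) (at2 coframe_poly a j) - pderiv (kerr_d j) (at2 coframe_poly a i)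
   + psum4 (fun b => at3 connection_poly i a b * at2 coframe_poly b j
                     - at3 connection_poly j a b * at2 coframe_poly b i))%spoly.

Lemma torsion_poly_eq0 : nil3 knf torsion_poly.
Proof. by vm_compute. Qed.

(** The indices a, b refer to the frame and i, j to the coordinates, so the curvature table is
    pulled back along the coframe in its second pair only. *)
Definition structure_poly (a i j b : nat) : spoly :=
  (pderiv (kerr_d i) (at3 connection_poly j a b) - pderiv (kerr_d j) (at3 connection_poly i a b)
   + psum4 (fun c => at3 connection_poly i a c * at3 connection_poly j c b
                     - at3 connection_poly j a c * at3 connection_poly i c b)
   - psum4 (fun d => psum4 (fun c => at2 coframe_poly c i * at4 curvature_poly a b c d)
                     * at2 coframe_poly d j))%spoly.

Lemma structure_poly_eq0 : all (fun a => nil3 knf (structure_poly a)) (iota 0 4).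
Proof. by vm_compute. Qed.

(** * Complex structure, Kaehler form and Lee form *)

Definition Jfield_poly := Eval vm_compute in
  mulmx_poly (mulmx_poly frame_poly J_poly) coframe_poly.

Lemma Jfield_polyE : Jfield_poly = mulmx_poly (mulmx_poly frame_poly J_poly) coframe_poly.
Proof. by vm_compute. Qed.

Definition kahler_poly := Eval vm_compute in
  mulmx_poly (mulmx_poly (trmx_poly coframe_poly) (trmx_poly J_poly)) coframe_poly.

Lemma kahler_polyE :
  kahler_poly = mulmx_poly (mulmx_poly (trmx_poly coframe_poly) (trmx_poly J_poly)) coframe_poly.
Proof. by vm_compute. Qed.

Definition nijenhuis_poly (k i j : nat) : spoly :=
  psum4 (fun l => at2 Jfield_poly l i * pderiv (kerr_d l) (at2 Jfield_poly k j)
    - at2 Jfield_poly l j * pderiv (kerr_d l) (at2 Jfield_poly k i)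
    - at2 Jfield_poly k l * (pderiv (kerr_d i) (at2 Jfield_poly l j)
                             - pderiv (kerr_d j) (at2 Jfield_poly l i)))%spoly.

Lemma nijenhuis_poly_eq0 : nil3 knf nijenhuis_poly.
Proof. by vm_compute. Qed.

Definition ext_d2_poly (t : seq (seq spoly)) (i j k : nat) : spoly :=
  (pderiv (kerr_d i) (at2 t j k) + pderiv (kerr_d j) (at2 t k i)
   + pderiv (kerr_d k) (at2 t i j))%spoly.

(* [1 / rho = (r + alpha cos theta) / Xi] *)
Definition invrho_poly : spoly := ((pr + pa * pc) * pY2)%spoly.

Definition lee_poly (i : nat) : spoly :=
  nth [::] [:: 2%:P * invrho_poly; 2%:P * pa * ps * invrho_poly]%spoly i.

(** States that the Lee form is 2 d rho / rho, the logarithmic derivative of rho^2. *)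
Lemma lee_poly_rho : nil3 knf (fun i _ _ =>
  lee_poly i - 2%:P * (pderiv (kerr_d i) (pr - pa * pc) * invrho_poly))%spoly.
Proof. by vm_compute. Qed.

Definition lee_eq_poly (i j k : nat) : spoly :=
  (ext_d2_poly kahler_poly i j k
   - (lee_poly i * at2 kahler_poly j k + lee_poly j * at2 kahler_poly k i
      + lee_poly k * at2 kahler_poly i j))%spoly.

Lemma lee_eq_poly_eq0 : nil3 knf lee_eq_poly.
Proof. by vm_compute. Qed.

(** [pK] will be evaluated at 6^(1/3) M^(2/3), so real powers never enter the polynomial
    computations. *)
Definition conf_poly : spoly := (pK * invrho_poly * invrho_poly)%spoly.

Definition conf_kahler_poly := tab2 (fun i j => conf_poly * at2 kahler_poly i j)%spoly.

Lemma conf_kahler_closed : nil3 knf (ext_d2_poly conf_kahler_poly).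
Proof. by vm_compute. Qed.

Definition ricci_poly (b d : nat) : spoly := psum4 (fun a => at4 curvature_poly a b a d).

Lemma ricci_poly_eq0 : nil3 knf (fun=> ricci_poly).
Proof. by vm_compute. Qed.

(* The coframe only depends on r and theta, so these are the only second
   derivatives whose order matters. *)
Lemma pderivC_coframe :
  nil3 knf (fun i a k => pderiv (kerr_d 0) (pderiv (kerr_d 1) (at2 coframe_poly a k))
                         - pderiv (kerr_d 1) (pderiv (kerr_d 0) (at2 coframe_poly a k)))%spoly.
Proof. by vm_compute. Qed.

Lemma mulmx_coframe_frame : tab2 (fun i j => if i == j then (1%:P)%spoly else [::])
  = mulmx_poly coframe_poly frame_poly.
Proof. by vm_compute. Qed.

Lemma J_poly_sqr : tab2 (fun i j => if i == j then ((-1)%:P)%spoly else [::])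
  = mulmx_poly J_poly J_poly.
Proof. by vm_compute. Qed.

Lemma connection_poly_anti :
  nil3 knf (fun i a b => at3 connection_poly i a b + at3 connection_poly i b a)%spoly.
Proof. by vm_compute. Qed.

Lemma curvature_poly_anti12 : all (fun a => nil3 knf (fun b c d =>
  at4 curvature_poly a b c d + at4 curvature_poly b a c d)%spoly) (iota 0 4).
Proof. by vm_compute. Qed.

Lemma curvature_poly_anti34 : all (fun a => nil3 knf (fun b c d =>
  at4 curvature_poly a b c d + at4 curvature_poly a b d c)%spoly) (iota 0 4).
Proof. by vm_compute. Qed.

Lemma pA_pB_invrho : nil3 knf (fun _ _ _ =>
  pA + pB + pM * (invrho_poly * invrho_poly * invrho_poly))%spoly.
Proof. by vm_compute. Qed.

(** * Partial derivatives *)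

(** Differentiability is local: the first-order expansion of [g] also holds for [f], and uniqueness
    of the differential makes it the differential of [f]. *)
Lemma near_eq_differentiable (K : numFieldType) (V W : normedModType K)
    (f g : V -> W) (p : V) :
  (\near p, f p = g p) -> differentiable g p -> differentiable f p.
Proof.
move=> fg dg; have fgp := nbhs_singleton fg.
have [dc dE] := (diff_locallyP _ _).1 dg.
have fE : f \o shift p = cst (f p) + 'd g p +o_ 0 id.
  apply/eqaddoP => e e0; move/eqaddoP: dE => /(_ e e0) dE.
  have : \forall h \near (0 : V), f (h + p) = g (h + p).
    by move: fg; rewrite (near_shift 0) /= subr0.
  by apply: filterS2 dE => h /= + gf; rewrite !fctE /= gf fgp.
have dfE := diff_unique dc fE.
by apply/diff_locallyP; rewrite dfE.
Qed.

Section PartialDerivatives.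
Context {R : realType}.
Implicit Types (f g : 'rV[R]_4 -> R) (p q : 'rV[R]_4) (i : 'I_4) (D : set 'rV[R]_4).

Lemma partial_near i f g p : (\near p, f p = g p) -> partial i f p = partial i g p.
Proof. exact: near_eq_derive. Qed.

Lemma partial_on D i f g p : open D -> (forall q, D q -> f q = g q) -> D p ->
  partial i f p = partial i g p.
Proof.
move=> oD fg Dp; apply: partial_near.
by apply: filterS (open_nbhs_nbhs (conj oD Dp)) => q; exact: fg.
Qed.

Lemma differentiable_on D f g p : open D -> (forall q, D q -> f q = g q) -> D p ->
  differentiable g p -> differentiable f p.
Proof.
move=> oD fg Dp; apply: near_eq_differentiable.
by apply: filterS (open_nbhs_nbhs (conj oD Dp)) => q; exact: fg.
Qed.

Lemma partial_cst i (a : R) p : partial i (fun=> a) p = 0.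
Proof. exact: derive_cst. Qed.

Lemma partialD i f g p : differentiable f p -> differentiable g p ->
  partial i (fun q => f q + g q) p = partial i f p + partial i g p.
Proof. by move=> df dg; rewrite /partial deriveD//; exact: diff_derivable. Qed.

Lemma partialM i f g p : differentiable f p -> differentiable g p ->
  partial i (fun q => f q * g q) p = partial i f p * g p + f p * partial i g p.
Proof.
move=> df dg; rewrite /partial deriveM; [|exact: diff_derivable..].
by rewrite addrC /GRing.scale/= [g p * _]mulrC.
Qed.

Lemma partial_comp i (h : R -> R) (dh : R) f p : differentiable f p ->
  is_derive (f p) 1 h dh ->
  differentiable (fun q => h (f q)) p /\
  partial i (fun q => h (f q)) p = partial i f p * dh.
Proof.
move=> df [dh1 dhE].
have dh2 : differentiable h (f p) by apply/derivable1_diffP.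
have dhf : differentiable (h \o f) p by exact: differentiable_comp.
split => //; rewrite /partial -[fun q => h (f q)]/(h \o f) deriveE// diff_comp//.
by rewrite /= deriv1E// -deriveE// derive1E dhE.
Qed.

Lemma partial_sum i (I : Type) (s : seq I) (f : I -> 'rV[R]_4 -> R) p :
  (forall k, differentiable (f k) p) ->
  differentiable (fun q => \sum_(k <- s) f k q) p /\
  partial i (fun q => \sum_(k <- s) f k q) p = \sum_(k <- s) partial i (f k) p.
Proof.
move=> df; elim: s => [|k s [IH1 IH2]].
  under eq_fun do rewrite big_nil.
  by rewrite partial_cst big_nil; split => //; exact: differentiable_cst.
under eq_fun do rewrite big_cons.
split; first exact: differentiableD.
by rewrite partialD// IH2 big_cons.
Qed.

(** The bridge from analysis to computation: by linearity and the Leibniz rule, a derivation that is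
    correct on the variables is correct on every polynomial. *)
Lemma partial_eval i (x : 'rV[R]_4 -> nat -> R) (dx : nat -> spoly) p P :
  (forall v, differentiable (fun q => x q v) p /\
             partial i (fun q => x q v) p = eval (x p) (dx v)) ->
  differentiable (fun q => eval (x q) P) p /\
  partial i (fun q => eval (x q) P) p = eval (x p) (pderiv dx P).
Proof.
move=> hx.
have hm (m : monomial) : differentiable (fun q => meval (x q) m) p /\
    partial i (fun q => meval (x q) m) p = eval (x p) (mderiv dx m).
  elim: m => [|v m [IH1 IH2]].
    rewrite /meval; under eq_fun do rewrite big_nil.
    by rewrite partial_cst eval0; split => //; exact: differentiable_cst.
  rewrite /meval; under eq_fun do rewrite big_cons.
  have [dv dvE] := hx v.
  split; first exact: differentiableM.
  rewrite partialM// IH2 dvE /= evalD !evalM eval_var eval_cons eval0 /= zval1.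
  by rewrite mul1r addr0 [_ * meval _ _]mulrC.
have ht (t : monomial * Z) : differentiable (fun q => zval t.2 * meval (x q) t.1) p.
  by apply: differentiableM; [exact: differentiable_cst|apply: (hm _).1].
have [d e] := partial_sum i P ht; split => //; rewrite e.
rewrite /pderiv eval_flatten big_map; apply: eq_bigr => t _.
rewrite partialM; [|exact: differentiable_cst|exact: (hm _).1].
rewrite partial_cst mul0r add0r (hm _).2 evalM eval_cons eval0 /meval big_nil.
by rewrite mulr1 addr0.
Qed.

Lemma is_derive_invsqrt (x : R) : 0 < x ->
  is_derive x 1 (fun y => (Num.sqrt y)^-1) (- (2^-1 * (Num.sqrt x)^-1 ^+ 3)).
Proof.
move=> x0.
have h := is_derive1_powR (- 2^-1) x0.
have e (y : R) : 0 < y -> y `^ (- 2^-1) = (Num.sqrt y)^-1.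
  by move=> y0; rewrite powRN powR12_sqrt// ltW.
apply: (@near_eq_is_derive _ _ _ (fun y : R => y `^ (- 2^-1))).
  by apply: filterS (open_nbhs_nbhs (conj (@open_gt _ 0) x0)) => y; exact: e.
apply: is_derive_eq.
(* The exponent -3/2 is split into three halves so that the power becomes the cube of the inverse
   root. *)
have -> : - 2^-1 - 1 = - 2^-1 + (- 2^-1) + (- 2^-1) :> R by field.
have x0' : x != 0 by rewrite gt_eqF.
rewrite !powRD; try by rewrite x0' implybT.
by rewrite e// /GRing.scale/= !exprS expr0; ring.
Qed.

End PartialDerivatives.

(** * Moving frames *)

Lemma invmx_eq (R : comUnitRingType) n (A B : 'M[R]_n) : A *m B = 1%:M -> invmx A = B.
Proof.
by move=> AB; have [uA _] := mulmx1_unit AB; rewrite -[RHS]mul1mx -(mulVmx uA) -mulmxA AB mulmx1.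
Qed.

Section MovingFrame.
Context {R : realType}.
Notation pt := 'rV[R]_4.
Implicit Types (F G : pt -> 'M[R]_4) (i j k l a b : 'I_4) (p : pt).

Definition partial_mx i F p : 'M[R]_4 := \matrix_(a, b) partial i (fun q => F q a b) p.

Definition differentiable_mx F p := forall a b, differentiable (fun q => F q a b) p.

Lemma differentiable_mulmx F G p : differentiable_mx F p -> differentiable_mx G p ->
  differentiable_mx (fun q => F q *m G q) p.
Proof.
move=> dF dG a b; under eq_fun do rewrite mxE.
apply: (@partial_sum _ 0 _ _ (fun k q => F q a k * G q k b) p _).1 => k.
exact: differentiableM.
Qed.

Lemma partial_mxM i F G p : differentiable_mx F p -> differentiable_mx G p ->
  partial_mx i (fun q => F q *m G q) p = partial_mx i F p *m G p + F p *m partial_mx i G p.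
Proof.
move=> dF dG; apply/matrixP => a b; rewrite !mxE.
under eq_fun do rewrite mxE.
rewrite (@partial_sum _ i _ _ (fun k q => F q a k * G q k b) p _).2; last first.
  by move=> k; exact: differentiableM.
rewrite -big_split/=; apply: eq_bigr => k _.
by rewrite partialM// !mxE.
Qed.

Lemma partial_mxD i F G p : differentiable_mx F p -> differentiable_mx G p ->
  partial_mx i (fun q => F q + G q) p = partial_mx i F p + partial_mx i G p.
Proof.
move=> dF dG; apply/matrixP => a b; rewrite !mxE -partialD//.
by congr partial; apply/funext => q; rewrite mxE.
Qed.

Variables (D : set pt) (g theta : pt -> 'M[R]_4) (omega : 'I_4 -> pt -> 'M[R]_4).
Hypothesis oD : open D.
Hypothesis g_theta : forall p, D p -> g p = (theta p)^T *m theta p.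
Hypothesis theta_unit : forall p, D p -> theta p \in unitmx.
Hypothesis d_theta : forall p, D p -> differentiable_mx theta p.
Hypothesis d_dual : forall p, D p -> differentiable_mx (fun q => dual_frame (theta q)) p.
Hypothesis dd_theta : forall i p, D p -> differentiable_mx (partial_mx i theta) p.
Hypothesis d_omega : forall i p, D p -> differentiable_mx (omega i) p.
Hypothesis dd_theta_sym : forall i j p, D p ->
  partial_mx i (partial_mx j theta) p = partial_mx j (partial_mx i theta) p.
Hypothesis omega_anti : forall i p, D p -> (omega i p)^T = - omega i p.

(** For the Levi-Civita connection the entry (a, j) is theta^a applied to nabla_(d_i) d_j, so
    vanishing torsion is its symmetry in i and j. *)
Definition cov_theta i p : 'M[R]_4 := partial_mx i theta p + omega i p *m theta p.

Hypothesis torsion_free : forall i j a p, D p -> cov_theta i p a j = cov_theta j p a i.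

Let E p := dual_frame (theta p).

Lemma dual_frameK p : D p -> E p *m theta p = 1%:M.
Proof. by move=> Dp; rewrite mulVmx ?theta_unit. Qed.

Lemma dual_frameVK p : D p -> theta p *m E p = 1%:M.
Proof. by move=> Dp; rewrite mulmxV ?theta_unit. Qed.

Lemma dual_frame_trK p : D p -> (E p)^T *m (theta p)^T = 1%:M.
Proof. by move=> Dp; rewrite -trmx_mul dual_frameVK// trmx1. Qed.

Lemma invmx_metric p : D p -> invmx (g p) = E p *m (E p)^T.
Proof.
move=> Dp; apply: invmx_eq; rewrite g_theta// !mulmxA -(mulmxA _ (theta p)).
by rewrite dual_frameVK// mulmx1 -trmx_mul dual_frameK// trmx1.
Qed.

(** Metric compatibility: by antisymmetry of [omega] its two contributions cancel, leaving the
    product rule for theta^T theta. *)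
Lemma partial_metric i p : D p ->
  partial_mx i g p = (cov_theta i p)^T *m theta p + (theta p)^T *m cov_theta i p.
Proof.
move=> Dp.
have dT : differentiable_mx (fun q => (theta q)^T) p.
  by move=> a b; under eq_fun do rewrite mxE; exact: d_theta.
have -> : partial_mx i g p = partial_mx i (fun q => (theta q)^T *m theta q) p.
  apply/matrixP => a b; rewrite !mxE; apply: (partial_on _ oD) => // q Dq.
  by rewrite g_theta.
rewrite partial_mxM//; last exact: d_theta.
have -> : partial_mx i (fun q => (theta q)^T) p = (partial_mx i theta p)^T.
  by apply/matrixP => a b; rewrite !mxE; congr partial; apply/funext => q; rewrite mxE.
rewrite /cov_theta linearD/= trmx_mul omega_anti// mulmxN mulmxDl mulmxDr mulNmx mulmxA.
by rewrite addrACA addNr addr0.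
Qed.

(* Cartan's characterization of the Levi-Civita connection: it is the only
   torsion-free one with antisymmetric connection matrices. *)
Lemma christoffel_frame k i j p : D p ->
  christoffel g k i j p = (E p *m cov_theta i p) k j.
Proof.
(* [P i j l] is the Christoffel symbol with lowered index l. The derivatives of g are sums of two
   such symbols, and the symmetry in i, j collapses the Koszul formula to 2 P. *)
move=> Dp; pose P i j l := \sum_a cov_theta i p a j * theta p a l.
have Psym i' j' l : P i' j' l = P j' i' l.
  by apply: eq_bigr => a _; rewrite torsion_free.
have dg i' j' l : partial i' (fun q => g q j' l) p = P i' j' l + P i' l j'.
  have /matrixP/(_ j' l) := partial_metric i' Dp; rewrite !mxE => ->.
  by congr (_ + _); apply: eq_bigr => a _; rewrite !mxE// mulrC.
have -> : christoffel g k i j p = \sum_l invmx (g p) k l * P i j l.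
  rewrite /christoffel mulr_sumr; apply: eq_bigr => l _.
  rewrite !dg (Psym j i l) (Psym i l j) (Psym j l i); by field.
have -> : E p *m cov_theta i p = invmx (g p) *m ((theta p)^T *m cov_theta i p).
  by rewrite invmx_metric// !mulmxA -(mulmxA _ (E p)^T) dual_frame_trK// mulmx1.
rewrite [RHS]mxE; apply: eq_bigr => l _; congr (_ * _).
by rewrite /P [RHS]mxE; apply: eq_bigr => a _; rewrite [X in _ = X * _]mxE mulrC.
Qed.

Definition curvature_form i j p : 'M[R]_4 :=
  partial_mx i (omega j) p - partial_mx j (omega i) p
  + (omega i p *m omega j p - omega j p *m omega i p).

(** Differentiate E theta = 1. *)
Lemma partial_dual_frame i p : D p ->
  partial_mx i E p = - (E p *m partial_mx i theta p *m E p).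
Proof.
move=> Dp.
have : partial_mx i (fun q => E q *m theta q) p = 0.
  apply/matrixP => a b; rewrite !mxE -(partial_cst i ((1%:M : 'M[R]_4) a b) p).
  by apply: (partial_on _ oD) => // q Dq; rewrite dual_frameK.
rewrite partial_mxM; [|exact: d_dual|exact: d_theta].
move/eqP; rewrite addr_eq0 => /eqP h.
by rewrite -mulNmx -h -mulmxA dual_frameVK// mulmx1.
Qed.

(** The Christoffel matrices are the gauge transform of [omega] by [theta], namely E (d_i theta +
    omega_i theta), and curvature is conjugated under a change of gauge. *)
Lemma riemann_up_frame k l i j p : D p ->
  riemann_up g p k l i j = (E p *m curvature_form i j p *m theta p) k l.
Proof.
move=> Dp.
have d_cov i' : differentiable_mx (cov_theta i') p.
  move=> a b; rewrite /cov_theta; under eq_fun do rewrite mxE.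
  apply: differentiableD; first exact: dd_theta.
  by apply: differentiable_mulmx; [exact: d_omega|exact: d_theta].
have dG i' j' : partial i' (christoffel g k j' l) p
    = partial_mx i' (fun q => E q *m cov_theta j' q) p k l.
  rewrite mxE; apply: (partial_on _ oD) => // q Dq; exact: christoffel_frame.
(* Apart from the last summand, the right side is symmetric in i' and j' once the second derivatives
   of [theta] commute; antisymmetrizing leaves the curvature form. *)
have X i' j' : partial_mx i' (fun q => E q *m cov_theta j' q) p
      + (E p *m cov_theta i' p) *m (E p *m cov_theta j' p)
    = E p *m (partial_mx i' (partial_mx j' theta) p
              + (omega j' p *m partial_mx i' theta p + omega i' p *m partial_mx j' theta p)
              + (partial_mx i' (omega j') p + omega i' p *m omega j' p) *m theta p).
  rewrite partial_mxM//; last exact: d_dual.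
  rewrite partial_dual_frame// {2}/cov_theta partial_mxD; last 2 first.
  - exact: dd_theta.
  - by apply: differentiable_mulmx; [exact: d_omega|exact: d_theta].
  rewrite partial_mxM; [|exact: d_omega|exact: d_theta].
  have -> : E p *m cov_theta i' p *m (E p *m cov_theta j' p)
    = E p *m partial_mx i' theta p *m E p *m cov_theta j' p
      + E p *m (omega i' p *m cov_theta j' p).
    rewrite {1}/cov_theta mulmxDr mulmxDl !mulmxA; congr (_ + _).
    by rewrite -(mulmxA _ (theta p)) dual_frameVK// mulmx1.
  rewrite mulNmx addrACA addNr add0r.
  rewrite -mulmxDr; congr (_ *m _).
  rewrite /cov_theta mulmxDr mulmxDl mulmxA.
  rewrite -[LHS]addrA -[RHS]addrA; congr (_ + _).
  by rewrite [X in X + _ = _]addrC addrACA.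
have -> : riemann_up g p k l i j =
  ((partial_mx i (fun q => E q *m cov_theta j q) p
      + (E p *m cov_theta i p) *m (E p *m cov_theta j p))
   - (partial_mx j (fun q => E q *m cov_theta i q) p
      + (E p *m cov_theta j p) *m (E p *m cov_theta i p))) k l.
  rewrite /riemann_up !dG big_split/= sumrN.
  have S i' j' : \sum_m christoffel g k i' m p * christoffel g m j' l p
     = ((E p *m cov_theta i' p) *m (E p *m cov_theta j' p)) k l.
    by rewrite [RHS]mxE; apply: eq_bigr => m _; rewrite !christoffel_frame.
  by rewrite !S opprD addrACA !mxE.
rewrite !X dd_theta_sym// -mulmxBr.
congr (fun_of_matrix _ k l); rewrite -mulmxA; congr (_ *m _).
rewrite [X in _ - (_ + X + _)]addrC opprD addrACA subrr add0r -mulmxBl.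
by congr (_ *m _); rewrite opprD addrACA.
Qed.

End MovingFrame.

(** * Tensors in an orthonormal frame *)

Section FrameTensors.
Context {R : realType}.
Notation tensor4 := ('I_4 -> 'I_4 -> 'I_4 -> 'I_4 -> R).
Implicit Types (T F : tensor4) (a b c d i j k l : 'I_4).

Lemma sum_congr_mx (X E : 'M[R]_4) a b :
  \sum_k \sum_l X k l * E k a * E l b = (E^T *m X *m E) a b.
Proof.
rewrite [RHS]mxE exchange_big; apply: eq_bigr => l _.
rewrite mxE mulr_suml; apply: eq_bigr => k _.
by rewrite mxE [X k l * _]mulrC.
Qed.

(** A tensor that is the pullback of F along the coframe has frame components F: the dual frame
    cancels [theta] first in the outer pair of slots, then in the inner one. *)
Lemma frame_components_pullback (theta : 'M[R]_4) T F a b c d : theta \in unitmx ->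
  (forall k l i j, T k l i j = (theta^T *m
     (\matrix_(a, b) (theta^T *m (\matrix_(c, d) F a b c d) *m theta) i j) *m theta) k l) ->
  frame_components theta T a b c d = F a b c d.
Proof.
move=> tU TE; pose E := dual_frame theta.
have EK (X : 'M[R]_4) : E^T *m (theta^T *m X *m theta) *m E = X.
  rewrite !mulmxA -trmx_mul mulmxV// trmx1 mul1mx -mulmxA mulmxV// mulmx1.
  by [].
rewrite /frame_components -/E.
transitivity (\sum_i \sum_j (theta^T *m (\matrix_(c, d) F a b c d) *m theta) i j
    * E i c * E j d); last first.
  by rewrite sum_congr_mx EK mxE.
transitivity (\sum_i \sum_j \sum_k \sum_l T k l i j * E k a * E l b * E i c * E j d).
  under eq_bigr do rewrite exchange_big.
  rewrite exchange_big; apply: eq_bigr => i _.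
  under eq_bigr do rewrite exchange_big.
  by rewrite exchange_big.
apply: eq_bigr => i _; apply: eq_bigr => j _.
under eq_bigr do rewrite -mulr_suml -mulr_suml.
rewrite -mulr_suml -mulr_suml; congr (_ * _ * _).
pose X := \matrix_(a, b) (theta^T *m (\matrix_(c, d) F a b c d) *m theta) i j.
transitivity (\sum_k \sum_l (theta^T *m X *m theta) k l * E k a * E l b).
  by apply: eq_bigr => k _; apply: eq_bigr => l _; rewrite TE.
by rewrite sum_congr_mx EK mxE.
Qed.

Lemma sum_eps (j : 'I_3) (X : 'I_3 -> 'I_3 -> R) :
  \sum_k \sum_l eps j k l * X k l = X (j + 1) (j + 1 + 1) - X (j + 1 + 1) (j + 1).
Proof.
rewrite !big_ord_recl !big_ord0.
case: j => [[|[|[|//]]] jlt]; rewrite /eps /= -?val_eqE /=;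
  rewrite !(mul0r, mul1r, mulN1r, add0r, addr0) 1?[- _ + _]addrC;
  by congr (X _ _ - X _ _); apply: val_inj.
Qed.

(** Addition modulo 3 puts the second factors in cyclic order, which accounts for e^4 /\ e^2 in the
    middle basis form. *)
Lemma Omega_wedge (s : R) (i : 'I_3) :
  Omega s i = wedge2 0 (lift ord0 i) + s *: wedge2 (lift ord0 (i + 1)) (lift ord0 (i + 1 + 1)).
Proof.
by case: i => [[|[|[|//]]] ilt]; rewrite /Omega /=; congr (wedge2 _ _ + _ *: wedge2 _ _);
  apply: val_inj.
Qed.

Lemma sum_wedge2 a b (X : 'I_4 -> 'I_4 -> R) :
  \sum_k \sum_l (wedge2 a b : 'M[R]_4) k l * X k l = X a b - X b a.
Proof.
have S a' b' : \sum_k \sum_l (delta_mx a' b' : 'M[R]_4) k l * X k l = X a' b'.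
  rewrite (bigD1 a')//= (bigD1 b')//= mxE !eqxx mul1r.
  rewrite big1 ?addr0; last by move=> l /negPf lb; rewrite mxE lb andbF mul0r.
  rewrite big1 ?addr0// => k /negPf ka; rewrite big1// => l _.
  by rewrite mxE ka mul0r.
rewrite -!S -sumrB; apply: eq_bigr => k _; rewrite -sumrB; apply: eq_bigr => l _.
by rewrite !mxE mulrBl.
Qed.

(** The value of an antisymmetric X on the i-th basis vector of Lambda^2_+. *)
Definition pair_dual (X : 'I_4 -> 'I_4 -> R) (i : 'I_3) : R :=
  X 0 (lift ord0 i) + X (lift ord0 (i + 1)) (lift ord0 (i + 1 + 1)).

Lemma sum_Omega (i : 'I_3) (X : 'I_4 -> 'I_4 -> R) : (forall a b, X b a = - X a b) ->
  \sum_k \sum_l (Omega 1 i : 'M[R]_4) k l * X k l = 2 * pair_dual X i.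
Proof.
move=> XA; rewrite Omega_wedge scale1r.
under eq_bigr do under eq_bigr do rewrite mxE mulrDl.
under eq_bigr do rewrite big_split.
rewrite big_split/= !sum_wedge2 (XA 0) (XA (lift ord0 (i + 1))) /pair_dual.
by ring.
Qed.

Lemma inner2_Omega (i : 'I_3) : inner2 (Omega 1 i) (Omega 1 i) = 2 :> R.
Proof.
rewrite /inner2 sum_Omega; last first.
  by move=> a b; rewrite Omega_wedge !mxE ![(b == _) && _]andbC; ring.
rewrite mulrA mulVf// mul1r /pair_dual Omega_wedge scale1r.
by case: i => [[|[|[|//]]] ilt]; rewrite !mxE /= -?val_eqE /=; ring.
Qed.

(** The factor 1/2 is the inverse squared norm of the basis form, as the elements of Omega_+ have
    squared length 2. *)
Lemma self_dual_block T (i j : 'I_3) :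
  (forall a b c d, T b a c d = - T a b c d) -> (forall a b c d, T a b d c = - T a b c d) ->
  ulsubmx (Lambda2_mx T) i j = 2^-1 * pair_dual (fun a b => pair_dual (T a b) j) i.
Proof.
move=> TA TB; rewrite !mxE /Lambda2_basis.
have sp (k : 'I_3) : fintype.split (lshift 3 k) = inl k by rewrite (unsplitK (inl k)).
rewrite !sp inner2_Omega {1}/inner2.
have LE a b : Lambda2_op T (Omega 1 i) a b = pair_dual (fun a' b' => T a' b' a b) i.
  by rewrite mxE sum_Omega// mulrA mulVf ?mul1r.
under eq_bigr do under eq_bigr do rewrite LE mulrC.
rewrite sum_Omega; last by move=> a b; rewrite /pair_dual !(TB _ _ a b); ring.
by rewrite /pair_dual; field.
Qed.

Lemma sum_eps_pair (X : 'I_4 -> 'I_4 -> R) (j : 'I_3) : (forall a b, X b a = - X a b) ->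
  X 0 (lift ord0 j) + 2^-1 * \sum_k \sum_l eps j k l * X (lift ord0 k) (lift ord0 l)
  = pair_dual X j.
Proof.
move=> XA; rewrite (sum_eps j (fun k l : 'I_3 => X (lift ord0 k) (lift ord0 l))).
by rewrite (XA (lift ord0 (j + 1))) /pair_dual; field.
Qed.

(** Each epsilon contraction completes a mixed component to a value on Lambda^2_+, so the formula
    for A is the same double contraction as the self-dual block. *)
Lemma Amx_pair_dual g (theta : 'rV[R]_4 -> 'M[R]_4) p (i j : 'I_3) :
  let T := frame_components (theta p) (riemann g p) in
  (forall a b c d, T b a c d = - T a b c d) -> (forall a b c d, T a b d c = - T a b c d) ->
  Amx g theta p i j = 2^-1 * pair_dual (fun a b => pair_dual (T a b) j) i.
Proof.
move=> T TA TB; rewrite mxE -/T; congr (_ * _).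
rewrite -(sum_eps_pair (X := fun a b => pair_dual (T a b) j)); last first.
  by move=> a b; rewrite /pair_dual !(TA a b); ring.
rewrite sum_eps_pair//; congr (_ + _ * _).
by apply: eq_bigr => m _; apply: eq_bigr => n _; rewrite sum_eps_pair.
Qed.

End FrameTensors.

(** * The Kerr domain *)

Section KerrDomain.
Context {R : realType}.
Variables (M alpha : R).
Hypotheses (hM : 0 < M) (ha : 0 < alpha).
Notation pt := 'rV[R]_4.
Implicit Types p q : pt.
Notation D := (kerr_domain M alpha).

Lemma continuous_coord (j : 'I_4) : continuous (fun q : pt => q 0 j).
Proof. by move=> q; apply: differentiable_continuous; exact: differentiable_coord. Qed.

Lemma open_kerr_domain : open D.
Proof.
have -> : D = (fun q : pt => q 0 0) @^-1` [set x | M + Num.sqrt (M ^+ 2 + alpha ^+ 2) < x]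
   `&` ((fun q : pt => q 0 1) @^-1` [set x | 0 < x] `&`
        (fun q : pt => q 0 1) @^-1` [set x | x < pi]).
  by apply/seteqP; split => q /=; [case=> ? /andP[]|case=> ? [? ?]; split=> //; apply/andP].
apply: openI; first by apply: open_comp => [q _|]; [exact: continuous_coord|exact: open_gt].
apply: openI; apply: open_comp => [q _|]; try exact: continuous_coord.
  exact: open_gt.
exact: open_lt.
Qed.

Lemma kerr_r_gt p : D p -> M + alpha < crd_r p.
Proof.
move=> [+ _]; apply: le_lt_trans; rewrite lerD2l -[leLHS]gtr0_norm// -sqrtr_sqr.
by rewrite ler_wsqrtr// lerDr sqr_ge0.
Qed.

Lemma Delta_gt0 p : D p -> 0 < Delta M alpha p.
Proof.
move=> [h _]; rewrite /Delta.
have s0 := sqrtr_ge0 (M ^+ 2 + alpha ^+ 2).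
have s2 : Num.sqrt (M ^+ 2 + alpha ^+ 2) ^+ 2 = M ^+ 2 + alpha ^+ 2.
  by rewrite sqr_sqrtr// addr_ge0// sqr_ge0.
(* Delta = (r - M)^2 - s^2, and r - M > s >= 0. *)
set s := Num.sqrt _ in h s0 s2 *; nra.
Qed.

Lemma sin_gt0 p : D p -> 0 < sin (crd_theta p).
Proof. by move=> [_ h]; apply: sin_gt0_pi. Qed.

(** On the domain r exceeds M + alpha, hence also alpha times any cosine. *)
Lemma rho_gt0 p : D p -> 0 < rho alpha p.
Proof.
move=> /kerr_r_gt h; rewrite /rho; have := cos_le1 (crd_theta p); have := hM; have := ha.
by nra.
Qed.

Lemma r_add_acos_gt0 p : D p -> 0 < crd_r p + alpha * cos (crd_theta p).
Proof.
move=> /kerr_r_gt h; have := cos_geN1 (crd_theta p); have := hM; have := ha.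
by nra.
Qed.

Lemma Xi_rho p : Xi alpha p = rho alpha p * (crd_r p + alpha * cos (crd_theta p)).
Proof. by rewrite /Xi /rho; ring. Qed.

Lemma Xi_gt0 p : D p -> 0 < Xi alpha p.
Proof. by move=> Dp; rewrite Xi_rho mulr_gt0 ?rho_gt0 ?r_add_acos_gt0. Qed.

Variable K : R.

(** The order is that of the variables [pM] to [pK]; indices beyond the list give 0. *)
Definition atoms p (v : nat) : R :=
  nth 0 [:: M; alpha; crd_r p; cos (crd_theta p); sin (crd_theta p);
            (Num.sqrt (Xi alpha p))^-1; (Num.sqrt (Delta M alpha p))^-1;
            (sin (crd_theta p))^-1; K] v.

Notation ev p := (eval (atoms p)).

Lemma Y2E p : D p -> Xi alpha p * (atoms p 5 * atoms p 5) = 1.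
Proof.
move=> Dp; rewrite /atoms /= -expr2 exprVn sqr_sqrtr ?mulfV//.
  by rewrite gt_eqF// Xi_gt0.
exact/ltW/Xi_gt0.
Qed.

Lemma Z2E p : D p -> Delta M alpha p * (atoms p 6 * atoms p 6) = 1.
Proof.
move=> Dp; rewrite /atoms /= -expr2 exprVn sqr_sqrtr ?mulfV//.
  by rewrite gt_eqF// Delta_gt0.
exact/ltW/Delta_gt0.
Qed.

Lemma valid_kerr_rules p : D p -> valid_rules (atoms p) kerr_rules.
Proof.
move=> Dp.
have hY := Y2E Dp; have hZ := Z2E Dp.
have hs : atoms p 4 * atoms p 4 + atoms p 3 * atoms p 3 = 1.
  by rewrite /= -!expr2 addrC cos2Dsin2.
have hS : atoms p 4 * atoms p 7 = 1 by rewrite /= mulfV// gt_eqF// sin_gt0.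
have hX : Xi alpha p = atoms p 2 ^+ 2 - atoms p 1 ^+ 2 * atoms p 3 ^+ 2 by [].
have hD : Delta M alpha p = atoms p 2 ^+ 2 - 2 * atoms p 0 * atoms p 2 - atoms p 1 ^+ 2 by [].
rewrite hX in hY; rewrite hD in hZ.
move: (atoms p) hs hS hY hZ => x hs hS hY hZ.
have hcS : x 3 * x 3 * x 7 = x 7 - x 4.
  have -> : x 3 * x 3 = 1 - x 4 * x 4 by rewrite -hs; ring.
  by rewrite mulrBl mul1r -mulrA hS mulr1.
have hcSS : x 7 * x 7 - x 3 * x 3 * (x 7 * x 7) = 1.
  by rewrite mulrA hcS mulrBl hS; ring.
(* These multiples of the relations are the ones that produce the derived rules; each rule is then a
   linear combination of the hypotheses, its monomials being treated as unknowns. *)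
have e1 := congr1 (fun t => t * x 7) hY.
have e2 := congr1 (fun t => t * (x 1 ^+ 2 * x 5 ^+ 2)) hcS.
have e3 := congr1 (fun t => t * (x 6 * x 6 * (x 7 * x 7))) hY.
have e4 := congr1 (fun t => t * (x 5 * x 5 * (x 7 * x 7))) hZ.
have e5 := congr1 (fun t => t * (x 1 * x 1 * x 5 * x 5 * x 6 * x 6)) hcSS.
move=> l; rewrite !inE => /or4P[|||/or4P[]] /eqP -> /=;
  rewrite ?evalE /= /meval ?big_cons ?big_nil /=; lra.
Qed.

Lemma eval_knf p P : D p -> ev p (knf P) = ev p P.
Proof. by move=> Dp; apply: eval_reduce; exact: valid_kerr_rules. Qed.

Lemma eval_nil3 f p (i j k : 'I_4) : nil3 knf f -> D p -> ev p (f i j k) = 0.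
Proof. by move=> /nil3P f0 Dp; rewrite -eval_knf// f0 eval0. Qed.

Lemma partial_coord (i j : 'I_4) p : partial i (fun q => q 0 j) p = (i == j)%:R.
Proof.
have did : derivable (id : pt -> pt) p (delta_mx 0 i) by exact: derivable_id.
have := derive_mx did.
rewrite derive_id => /matrixP/(_ 0 j); rewrite !mxE /= => e.
by rewrite /partial -e eq_sym.
Qed.

(** The base case that [partial_eval] requires. *)
Lemma partial_atoms i p v : D p ->
  differentiable (fun q => atoms q v) p /\
  partial i (fun q => atoms q v) p = ev p (kerr_d i v).
Proof.
move=> Dp.
have cst (a : R) : differentiable (fun=> a) p /\ partial i (fun _ : pt => a) p = 0.
  by split; [exact: differentiable_cst|exact: partial_cst].
have dr : differentiable (@crd_r R) p by exact: differentiable_coord.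
have dt : differentiable (@crd_theta R) p by exact: differentiable_coord.
have [dc dcE] := partial_comp i dt (is_derive_cos _).
have [ds dsE] := partial_comp i dt (is_derive_sin _).
have dr1 : partial i (@crd_r R) p = (i == 0)%:R by exact: partial_coord.
have dt1 : partial i (@crd_theta R) p = (i == 1)%:R by exact: partial_coord.
have dX : differentiable (Xi alpha) p /\ partial i (Xi alpha) p =
   2 * crd_r p * (i == 0)%:R + 2 * alpha ^+ 2 * cos (crd_theta p) * sin (crd_theta p) * (i == 1)%:R.
  have -> : Xi alpha = fun q => crd_r q * crd_r q
      + - (alpha ^+ 2) * (cos (crd_theta q) * cos (crd_theta q)).
    by apply/funext => q; rewrite /Xi; ring.
  have drr : differentiable (fun q : pt => crd_r q * crd_r q) p by exact: differentiableM.
  have dcc : differentiable (fun q : pt => cos (crd_theta q) * cos (crd_theta q)) p.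
    exact: differentiableM.
  have dacc : differentiable (fun q : pt => - (alpha ^+ 2) *
      (cos (crd_theta q) * cos (crd_theta q))) p.
    by apply: differentiableM; [exact: (cst _).1|exact: dcc].
  split; first exact: differentiableD.
  by rewrite partialD// !partialM// partial_cst dr1 dcE dt1; ring.
have dD : differentiable (Delta M alpha) p /\ partial i (Delta M alpha) p =
   2 * (crd_r p - M) * (i == 0)%:R.
  have -> : Delta M alpha = fun q => crd_r q * crd_r q + (- (2 * M) * crd_r q + - alpha ^+ 2).
    by apply/funext => q; rewrite /Delta; ring.
  have drr : differentiable (fun q : pt => crd_r q * crd_r q) p by exact: differentiableM.
  have dMr : differentiable (fun q : pt => - (2 * M) * crd_r q) p.
    by apply: differentiableM; [exact: (cst _).1|exact: dr].
  have dMra : differentiable (fun q : pt => - (2 * M) * crd_r q + - alpha ^+ 2) p.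
    by apply: differentiableD; [exact: dMr|exact: (cst _).1].
  split; first exact: differentiableD.
  by rewrite !partialD// !partialM// !partial_cst dr1; ring.
have [dY dYE] := partial_comp i dX.1 (is_derive_invsqrt (Xi_gt0 Dp)).
have [dZ dZE] := partial_comp i dD.1 (is_derive_invsqrt (Delta_gt0 Dp)).
have dS : differentiable (fun q : pt => (sin (crd_theta q))^-1) p /\
    partial i (fun q : pt => (sin (crd_theta q))^-1) p =
    (i == 1)%:R * cos (crd_theta p) * - ((sin (crd_theta p))^-1 ^+ 2).
  have s0 : sin (crd_theta p) != 0 by rewrite gt_eqF// sin_gt0.
  split; first exact: differentiableV.
  rewrite /partial deriveV//; last exact: diff_derivable.
  rewrite -/(partial i _ p) dsE dt1 /GRing.scale/= exprVn; ring.
have rhs : [/\ ev p (kerr_d i 2) = (i == 0)%:R,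
    ev p (kerr_d i 3) = (i == 1)%:R * - sin (crd_theta p),
    ev p (kerr_d i 4) = (i == 1)%:R * cos (crd_theta p),
    ev p (kerr_d i 7) = (i == 1)%:R * cos (crd_theta p) * - ((sin (crd_theta p))^-1 ^+ 2)
    & forall v, v \notin [:: 2; 3; 4; 5; 6; 7]%N -> kerr_d i v = [::]].
  split; try by (move: i {dc dcE ds dsE dr1 dt1 dX dD dY dYE dZ dZE dS cst};
    case=> [[|[|[|[|//]]]] ilt]; rewrite -?val_eqE /= ?evalE /atoms /=; ring).
  case: (i : nat) => [|[|n]]; case=> [|[|[|[|[|[|[|[|[|u]]]]]]]]] //= _;
    by rewrite /kerr_d /kerr_dr /kerr_dtheta /= ?nth_nil.
have rhs5 : ev p (kerr_d i 5) = partial i (Xi alpha) p * - (2^-1 * atoms p 5 ^+ 3).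
  rewrite dX.2; move: i {dc dcE ds dsE dr1 dt1 dX dD dY dYE dZ dZE dS cst rhs};
    case=> [[|[|[|[|//]]]] ilt]; rewrite -?val_eqE /= ?evalE /=; rewrite /atoms /=;
    move: ((Num.sqrt (Xi alpha p))^-1) => y; by field.
have rhs6 : ev p (kerr_d i 6) = partial i (Delta M alpha) p * - (2^-1 * atoms p 6 ^+ 3).
  rewrite dD.2; move: i {dc dcE ds dsE dr1 dt1 dX dD dY dYE dZ dZE dS cst rhs rhs5};
    case=> [[|[|[|[|//]]]] ilt]; rewrite -?val_eqE /= ?evalE /=; rewrite /atoms /=;
    move: ((Num.sqrt (Delta M alpha p))^-1) => z; by field.
case: rhs => r2 r3 r4 r7 r0.
case: v => [|[|[|[|[|[|[|[|[|v]]]]]]]]].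
- by rewrite r0// evalE; exact: cst.
- by rewrite r0// evalE; exact: cst.
- by rewrite r2.
- by rewrite r3 -dt1.
- by rewrite r4 -dt1.
- by rewrite rhs5.
- by rewrite rhs6.
- by rewrite r7.
- by rewrite r0// evalE; exact: cst.
by rewrite r0// evalE /atoms /= nth_nil; exact: cst.
Qed.

End KerrDomain.

(** * The Kerr geometry in its orthonormal frame *)

Section KerrGeometry.
Context {R : realType}.
Variables (M alpha K : R).
Hypotheses (hM : 0 < M) (ha : 0 < alpha).
Notation pt := 'rV[R]_4.
Implicit Types (p q : pt) (f : pt -> R) (P : spoly) (A B : seq (seq spoly)).
Notation D := (kerr_domain M alpha).
Notation ev p := (eval (atoms M alpha K p)).
Notation g := (kerr_metric M alpha).
Notation theta := (kerr_coframe M alpha).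
Notation J := (kerr_J M alpha).
Notation oD := (@open_kerr_domain R M alpha).

(** Equality is demanded on the domain only; as the domain is open, this suffices for
    derivatives. *)
Definition represents f P := forall q, D q -> f q = ev q P.

Lemma represents_differentiable f P p : represents f P -> D p -> differentiable f p.
Proof.
move=> fP Dp; apply: (differentiable_on oD fP Dp).
by apply: (partial_eval P (i := 0) _).1 => v; exact: partial_atoms.
Qed.

Lemma represents_partial f P i : represents f P ->
  represents (partial i f) (pderiv (kerr_d i) P).
Proof.
move=> fP p Dp; rewrite (partial_on _ oD fP Dp).
by apply: (partial_eval P _).2 => v; exact: partial_atoms.
Qed.

(** Partial derivatives of represented functions are represented again, so every class C^n follows
    by induction over all [f] and [P] at once. *)
Lemma represents_smooth f P : represents f P -> smooth_on D f.
Proof.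
move=> fP n; elim: n f P fP => [|n IH] f P fP /=.
  by move=> p Dp; apply: differentiable_continuous; exact: represents_differentiable fP Dp.
split=> [p Dp|i]; first exact: represents_differentiable fP Dp.
exact: IH (represents_partial i fP).
Qed.

Definition evmx p A : 'M[R]_4 := \matrix_(i, j) ev p (at2 A i j).

Lemma evmx_mul p A B : D p -> evmx p (mulmx_poly A B) = evmx p A *m evmx p B.
Proof.
move=> Dp; apply/matrixP => i j; rewrite !mxE at2_tab eval_knf// eval_psum4.
by apply: eq_bigr => k _; rewrite evalM !mxE.
Qed.

Lemma evmx_tr p A : evmx p (trmx_poly A) = (evmx p A)^T.
Proof. by apply/matrixP => i j; rewrite !mxE at2_tab. Qed.

Lemma kerr_coframe_evmx p : D p -> theta p = evmx p coframe_poly.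
Proof.
move=> Dp; have X0 := Xi_gt0 hM ha Dp; have D0 := Delta_gt0 Dp.
have sX : Num.sqrt (Xi alpha p) = Xi alpha p * (Num.sqrt (Xi alpha p))^-1.
  by rewrite -{2}[Xi alpha p]sqr_sqrtr ?ltW// expr2 mulfK// gt_eqF// sqrtr_gt0.
have sD : Num.sqrt (Delta M alpha p) = Delta M alpha p * (Num.sqrt (Delta M alpha p))^-1.
  by rewrite -{2}[Delta M alpha p]sqr_sqrtr ?ltW// expr2 mulfK// gt_eqF// sqrtr_gt0.
have sXD : Num.sqrt (Xi alpha p / Delta M alpha p) =
    Xi alpha p * (Num.sqrt (Xi alpha p))^-1 * (Num.sqrt (Delta M alpha p))^-1.
  by rewrite sqrtrM ?ltW// sqrtrV ?ltW// {1}sX.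
have sDX : Num.sqrt (Delta M alpha p / Xi alpha p) =
    Delta M alpha p * (Num.sqrt (Delta M alpha p))^-1 * (Num.sqrt (Xi alpha p))^-1.
  by rewrite sqrtrM ?ltW// sqrtrV ?ltW// {1}sD.
(* [sX] is used only in the row of e^2: the row of e^3 must keep its inverse root. *)
apply/matrixP => a j; rewrite !mxE sXD sDX [X in [:: _; X *: _; _; _]]sX.
case: a => [[|[|[|[|//]]]] alt]; case: j => [[|[|[|[|//]]]] jlt];
  rewrite /= !mxE /= ?evalE /atoms /=;
  move: ((Num.sqrt (Xi alpha p))^-1) ((Num.sqrt (Delta M alpha p))^-1) => y z;
  by rewrite /Xi /Delta; ring.
Qed.

Lemma sqr_formE (v : 'rV[R]_4) i j : sqr_form v i j = v 0 i * v 0 j.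
Proof. by rewrite mxE big_ord1 mxE. Qed.

Lemma kerr_metric_coframe p : D p -> g p = (theta p)^T *m theta p.
Proof.
move=> Dp; have X0 := Xi_gt0 hM ha Dp; have D0 := Delta_gt0 Dp.
have h1 : Num.sqrt (Xi alpha p / Delta M alpha p) ^+ 2 = Xi alpha p / Delta M alpha p.
  by rewrite sqr_sqrtr// divr_ge0 ?ltW.
have h2 : Num.sqrt (Xi alpha p) ^+ 2 = Xi alpha p by rewrite sqr_sqrtr ?ltW.
have h4 : Num.sqrt (Delta M alpha p / Xi alpha p) ^+ 2 = Delta M alpha p / Xi alpha p.
  by rewrite sqr_sqrtr// divr_ge0 ?ltW.
have h3 : (sin (crd_theta p) / Num.sqrt (Xi alpha p)) ^+ 2 = sin (crd_theta p) ^+ 2 / Xi alpha p.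
  by rewrite expr_div_n h2.
have E (v : 'rV[R]_4) (n : R) i j : (n *: v) 0 i * (n *: v) 0 j = n ^+ 2 * sqr_form v i j.
  by rewrite sqr_formE !mxE; ring.
have S i j : ((theta p)^T *m theta p) i j = \sum_a theta p a i * theta p a j.
  by rewrite mxE; apply: eq_bigr => a _; rewrite mxE.
apply/matrixP => i j; rewrite S !big_ord_recl big_ord0 ![kerr_coframe _ _ _ _ _]mxE /= !E.
rewrite h1 h2 h3 h4 /kerr_metric.
move: (sqr_form d_r) (sqr_form d_theta) (sqr_form (sigma_form alpha p))
  (sqr_form (tau_form alpha p)) => A B C F.
by rewrite !mxE; ring.
Qed.

Lemma coframeK p : D p -> theta p *m evmx p frame_poly = 1%:M.
Proof.
move=> Dp; rewrite kerr_coframe_evmx// -evmx_mul// -mulmx_coframe_frame.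
apply/matrixP => i j; rewrite !mxE at2_tab -val_eqE.
by case: eqP; rewrite evalE.
Qed.

Lemma kerr_coframe_unit p : D p -> theta p \in unitmx.
Proof. by move=> /coframeK /mulmx1_unit[]. Qed.

Lemma dual_frame_evmx p : D p -> dual_frame (theta p) = evmx p frame_poly.
Proof. by move=> /coframeK/invmx_eq. Qed.

Lemma J_frame_evmx p : J_frame = evmx p J_poly.
Proof.
apply/matrixP => i j; rewrite !mxE.
by case: i => [[|[|[|[|//]]]] ilt]; case: j => [[|[|[|[|//]]]] jlt];
  rewrite -?val_eqE /= ?evalE; ring.
Qed.

Lemma kerr_J_evmx p : D p -> J p = evmx p Jfield_poly.
Proof.
move=> Dp; rewrite Jfield_polyE !evmx_mul// -J_frame_evmx -dual_frame_evmx//.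
by rewrite -kerr_coframe_evmx.
Qed.

(** Writing g as theta^T theta cancels the dual frame inside J, so the form has constant frame
    components. *)
Lemma kahler_form_frame p : D p ->
  kahler_form g J p = (theta p)^T *m J_frame^T *m theta p.
Proof.
move=> Dp; have EK : (dual_frame (theta p))^T *m (theta p)^T = 1%:M.
  by rewrite -trmx_mul mulmxV ?kerr_coframe_unit// trmx1.
rewrite /kahler_form kerr_metric_coframe// /kerr_J !trmx_mul !mulmxA.
by rewrite -(mulmxA _ _ (theta p)^T) EK mulmx1.
Qed.

Lemma kahler_form_evmx p : D p -> kahler_form g J p = evmx p kahler_poly.
Proof.
move=> Dp; rewrite kahler_form_frame// kahler_polyE !evmx_mul// !evmx_tr.
by rewrite -J_frame_evmx -kerr_coframe_evmx.
Qed.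

Lemma represents_coframe a j : represents (fun q => theta q a j) (at2 coframe_poly a j).
Proof. by move=> q Dq; rewrite kerr_coframe_evmx// mxE. Qed.

Lemma represents_J i j : represents (fun q => J q i j) (at2 Jfield_poly i j).
Proof. by move=> q Dq; rewrite kerr_J_evmx// mxE. Qed.

Lemma represents_kahler_form i j :
  represents (fun q => kahler_form g J q i j) (at2 kahler_poly i j).
Proof. by move=> q Dq; rewrite kahler_form_evmx// mxE. Qed.

Definition metric_poly (i j : nat) : spoly :=
  psum4 (fun a => at2 coframe_poly a i * at2 coframe_poly a j)%spoly.

Lemma represents_metric i j : represents (fun q => g q i j) (metric_poly i j).
Proof.
move=> q Dq; rewrite kerr_metric_coframe// mxE eval_psum4.
by apply: eq_bigr => a _; rewrite mxE evalM !represents_coframe.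
Qed.

Definition kerr_connection (i : 'I_4) p : 'M[R]_4 := evmx p (nth [::] connection_poly i).

Lemma represents_connection i a b :
  represents (fun q => kerr_connection i q a b) (at3 connection_poly i a b).
Proof. by move=> q Dq; rewrite mxE. Qed.

Definition kerr_curvature p : 'I_4 -> 'I_4 -> 'I_4 -> 'I_4 -> R :=
  fun a b c d => ev p (at4 curvature_poly a b c d).

Lemma kerr_torsion_free i j a p : D p ->
  cov_theta theta kerr_connection i p a j = cov_theta theta kerr_connection j p a i.
Proof.
move=> Dp; apply/subr0_eq; have := eval_nil3 hM ha K i j a torsion_poly_eq0 Dp.
rewrite /torsion_poly evalD evalB eval_psum4 => <-.
rewrite !mxE !(represents_partial _ (represents_coframe _ _) Dp).
rewrite opprD addrACA -sumrB; congr (_ + _); apply: eq_bigr => b _.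
by rewrite evalB !evalM !represents_coframe// !represents_connection.
Qed.

(** Derivatives along t and phi vanish in either position; the remaining pair r, theta is settled by
    [pderivC_coframe]. *)
Lemma kerr_dd_theta_sym i j p : D p ->
  partial_mx i (partial_mx j theta) p = partial_mx j (partial_mx i theta) p.
Proof.
move=> Dp.
have pp i' j' a b : partial_mx i' (partial_mx j' theta) p a b =
    ev p (pderiv (kerr_d i') (pderiv (kerr_d j') (at2 coframe_poly a b))).
  rewrite mxE; under eq_fun do rewrite mxE.
  exact: (represents_partial _ (represents_partial _ (represents_coframe a b))).
apply/matrixP => a b; rewrite [LHS]pp [RHS]pp {pp}.
have d0 (i' : 'I_4) P : (1 < i')%N -> ev p (pderiv (kerr_d i') P) = 0.
  move=> lt1i; apply: eval_pderiv0 => v.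
  by case: i' lt1i => [[|[|[|[|//]]]] ilt] //= _; rewrite /kerr_d /= ?nth_nil.
have d2 (i' j' : 'I_4) P : (1 < j')%N ->
    ev p (pderiv (kerr_d i') (pderiv (kerr_d j') P)) = 0.
  move=> lt1j; have f0 : represents (fun=> 0) (pderiv (kerr_d j') P).
    move=> q Dq; rewrite eval_pderiv0// => v.
    by case: j' lt1j => [[|[|[|[|//]]]] ilt] //= _; rewrite /kerr_d /= ?nth_nil.
  by rewrite -(represents_partial i' f0 Dp) partial_cst.
have [i1|i1] := ltnP 1 i; first by rewrite d0// d2.
have [j1|j1] := ltnP 1 j; first by rewrite d2// d0.
have := eval_nil3 hM ha K i a b pderivC_coframe Dp; rewrite evalB => /subr0_eq e.
by case: i i1 e => [[|[|//]] ilt] /= _ e; case: j j1 => [[|[|//]] jlt] /= _.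
Qed.

Lemma kerr_structure i j a b p : D p ->
  curvature_form kerr_connection i j p a b =
  ((theta p)^T *m (\matrix_(c, d) kerr_curvature p a b c d) *m theta p) i j.
Proof.
move=> Dp; apply/subr0_eq.
have m (n : 'I_4) : nat_of_ord n \in iota 0 4 by rewrite mem_iota ltn_ord.
have := eval_nil3 hM ha K i j b (allP structure_poly_eq0 _ (m a)) Dp.
rewrite /structure_poly evalB evalD evalB !eval_psum4 => <-.
rewrite !mxE !(represents_partial _ (represents_connection _ _ _) Dp) -sumrB.
congr (_ + _ - _).
  by apply: eq_bigr => c _; rewrite evalB !evalM !represents_connection.
apply: eq_bigr => d _; rewrite evalM represents_coframe// eval_psum4 mxE.
congr (_ * _); apply: eq_bigr => c _.
by rewrite evalM [(_^T) _ _]mxE represents_coframe// [(\matrix_(_, _) _) _ _]mxE.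
Qed.

Lemma kerr_connection_anti (i : 'I_4) p : D p -> (kerr_connection i p)^T = - kerr_connection i p.
Proof.
move=> Dp; apply/matrixP => a b; rewrite !mxE; apply/eqP; rewrite -addr_eq0.
have := eval_nil3 hM ha K i b a connection_poly_anti Dp.
by rewrite evalD => /eqP.
Qed.

(** * Riemann and Ricci tensors of the Kerr metric *)

Lemma kerr_riemann_up k l i j p : D p ->
  riemann_up g p k l i j =
  (dual_frame (theta p) *m curvature_form kerr_connection i j p *m theta p) k l.
Proof.
move=> Dp.
have d_theta q : D q -> differentiable_mx theta q.
  by move=> Dq a b; exact: represents_differentiable (represents_coframe a b) Dq.
have d_dual q : D q -> differentiable_mx (fun q => dual_frame (theta q)) q.
  move=> Dq a b; apply: (represents_differentiable (P := at2 frame_poly a b)) Dq.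
  by move=> q' Dq'; rewrite dual_frame_evmx// mxE.
have dd_theta i' q : D q -> differentiable_mx (partial_mx i' theta) q.
  move=> Dq a b; under eq_fun do rewrite mxE.
  exact: represents_differentiable (represents_partial i' (represents_coframe a b)) Dq.
have d_conn (i' : 'I_4) q : D q -> differentiable_mx (kerr_connection i') q.
  by move=> Dq a b; exact: represents_differentiable (represents_connection i' a b) Dq.
exact: (riemann_up_frame oD kerr_metric_coframe kerr_coframe_unit d_theta d_dual
  dd_theta d_conn kerr_dd_theta_sym kerr_connection_anti kerr_torsion_free).
Qed.

Lemma kerr_riemann p a b c d : D p ->
  frame_components (theta p) (riemann g p) a b c d = kerr_curvature p a b c d.
Proof.
move=> Dp; apply: frame_components_pullback; first exact: kerr_coframe_unit.
move=> k l i j.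
have -> : riemann g p k l i j =
    (g p *m (dual_frame (theta p) *m curvature_form kerr_connection i j p *m theta p)) k l.
  by rewrite mxE; apply: eq_bigr => m _; rewrite kerr_riemann_up.
(* Lowering the index with theta^T theta absorbs the dual frame and leaves the curvature form pulled
   back in the first pair; [kerr_structure] does the second pair. *)
rewrite kerr_metric_coframe// !mulmxA -(mulmxA _ (theta p)) mulmxV ?kerr_coframe_unit//.
rewrite mulmx1; congr (fun_of_matrix (_ *m _ *m _) _ _).
by apply/matrixP => a' b'; rewrite kerr_structure// mxE.
Qed.

(** The coordinate trace is rewritten as a trace over the frame, where the contracted curvature
    table vanishes. *)
Lemma kerr_ricci p : D p -> ricci g p = 0.
Proof.
move=> Dp; apply/matrixP => l j; rewrite [RHS]mxE mxE.
transitivity (\sum_b (\sum_a \sum_k dual_frame (theta p) k a *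
    curvature_form kerr_connection k j p a b) * theta p b l).
  under eq_bigr do rewrite kerr_riemann_up// mxE.
  rewrite exchange_big; apply: eq_bigr => b _; rewrite -mulr_suml; congr (_ * _).
  by rewrite exchange_big; apply: eq_bigr => k _; rewrite mxE.
apply: big1 => b _; apply/eqP; rewrite mulf_eq0; apply/orP; left; apply/eqP.
transitivity (\sum_a \sum_d kerr_curvature p a b a d * theta p d j).
  apply: eq_bigr => a _.
  transitivity (((dual_frame (theta p))^T *m ((theta p)^T *m
     (\matrix_(c, d) kerr_curvature p a b c d) *m theta p)) a j).
    by rewrite [RHS]mxE; apply: eq_bigr => k _; rewrite kerr_structure// [in RHS]mxE.
  rewrite !mulmxA -trmx_mul mulmxV ?kerr_coframe_unit// trmx1 mul1mx mxE.
  by apply: eq_bigr => d _; rewrite mxE.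
rewrite exchange_big big1//= => d _; rewrite -mulr_suml.
have := eval_nil3 hM ha K b b d ricci_poly_eq0 Dp.
by rewrite eval_psum4 => ->; rewrite mul0r.
Qed.

End KerrGeometry.

(** * Weyl tensor, conformal factor and Kaehler structure *)

(** A factorization into linear factors is unique up to order, so the list chosen by [xget] has the
    same sum of squares as [s]. *)
Lemma eigen_norm_prod (R : realType) n (A : 'M[R]_n) (s : seq R) :
  char_poly A = \prod_(x <- s) ('X - x%:P) ->
  eigen_norm A = Num.sqrt (\sum_(x <- s) x ^+ 2).
Proof.
move=> AE; rewrite /eigen_norm; congr Num.sqrt; apply: perm_big.
apply: prod_XsubC_eq; rewrite -AE; apply: esym.
exact: (@xgetPex _ [::] [set s : seq R | char_poly A = \prod_(x <- s) ('X - x%:P)])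
  (ex_intro _ s AE).
Qed.

(** Wedging with a nondegenerate 2-form is injective on 1-forms in dimension 4; this gives the
    uniqueness of the Lee form. *)
Lemma wedge12_inj (R : realType) (om : 'M[R]_4) (xi eta : 'rV[R]_4) :
  om \in unitmx -> om^T = - om ->
  (forall i j k, wedge12 xi om i j k = wedge12 eta om i j k) -> xi = eta.
Proof.
move=> oU oA h; pose z := xi - eta; apply/subr0_eq; rewrite -/z.
have hz i j k : z 0 i * om j k + z 0 j * om k i + z 0 k * om i j = 0.
  by have := h i j k; rewrite /wedge12 => e; rewrite !mxE; lra.
pose N := invmx om.
have NA : N^T = - N.
  by rewrite trmx_inv oA; apply: invmx_eq; rewrite mulNmx mulmxN opprK mulmxV.
have NA' a b : N b a = - N a b by move/matrixP: NA => /(_ a b); rewrite !mxE.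
have omA a b : om b a = - om a b by move/matrixP: oA => /(_ a b); rewrite !mxE.
have oN a b : \sum_c om a c * N c b = (a == b)%:R.
  by have /matrixP/(_ a b) := mulmxV oU; rewrite !mxE.
apply/rowP => i; rewrite [RHS]mxE.
(* Contraction with the inverse of [om]: the first term gives 4 z_i and the other two -z_i each, so
   2 z_i = 0. *)
have : \sum_j \sum_k (z 0 i * (om j k * N k j) + z 0 j * (om k i * N k j)
    + z 0 k * (om i j * N k j)) = 0.
  apply: big1 => j _; apply: big1 => k _.
  by rewrite -[RHS](mul0r (N k j)) -(hz i j k); ring.
under eq_bigr do rewrite !big_split/= -!mulr_sumr oN eqxx.
rewrite !big_split/= -mulr_sumr sumr_const card_ord.
have delta (f : 'I_4 -> R) : \sum_j f j * (i == j)%:R = f i.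
  rewrite (bigD1 i)//= eqxx mulr1 big1 ?addr0// => j /negPf ji.
  by rewrite eq_sym ji mulr0.
have -> : \sum_j z 0 j * (\sum_k om k i * N k j) = - z 0 i.
  rewrite -(delta (fun j => - z 0 j)); apply: eq_bigr => j _.
  rewrite -oN mulNr -mulrN -sumrN; congr (_ * _); apply: eq_bigr => k _.
  by rewrite omA mulNr.
have -> : \sum_j \sum_k z 0 k * (om i j * N k j) = - z 0 i.
  rewrite exchange_big -(delta (fun j => - z 0 j)); apply: eq_bigr => k _ /=.
  rewrite -oN mulNr -mulrN -sumrN -mulr_sumr; congr (_ * _); apply: eq_bigr => j _.
  by rewrite (NA' j k) mulrN.
by move=> e; lra.
Qed.

Section KerrTheorem.
Context {R : realType}.
Variables (M alpha : R).
Hypotheses (hM : 0 < M) (ha : 0 < alpha).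
Notation pt := 'rV[R]_4.
Implicit Types (p q : pt).
Notation D := (kerr_domain M alpha).
Notation g := (kerr_metric M alpha).
Notation theta := (kerr_coframe M alpha).
Notation J := (kerr_J M alpha).
Notation W := (kerr_Wplus M alpha).

Definition conf_const : R := 6 `^ (1 / 3) * M `^ (2 / 3).

Notation ev p := (eval (atoms M alpha conf_const p)).
Notation curv := (kerr_curvature M alpha conf_const).

Lemma kerr_curvature_anti12 p a b c d : D p -> curv p b a c d = - curv p a b c d.
Proof.
move=> Dp; apply/eqP; rewrite -addr_eq0 addrC.
have m (n : 'I_4) : nat_of_ord n \in iota 0 4 by rewrite mem_iota ltn_ord.
have := eval_nil3 hM ha conf_const b c d (allP curvature_poly_anti12 _ (m a)) Dp.
by rewrite evalD => ->.
Qed.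

Lemma kerr_curvature_anti34 p a b c d : D p -> curv p a b d c = - curv p a b c d.
Proof.
move=> Dp; apply/eqP; rewrite -addr_eq0 addrC.
have m (n : 'I_4) : nat_of_ord n \in iota 0 4 by rewrite mem_iota ltn_ord.
have := eval_nil3 hM ha conf_const b c d (allP curvature_poly_anti34 _ (m a)) Dp.
by rewrite evalD => ->.
Qed.

Lemma eval_invrho p : D p -> ev p invrho_poly = (rho alpha p)^-1.
Proof.
move=> Dp; have r0 : rho alpha p != 0 by rewrite gt_eqF// (rho_gt0 hM ha).
have := Y2E hM ha conf_const Dp; rewrite Xi_rho => e.
apply: (mulfI r0); rewrite mulfV// -e /invrho_poly ?evalE /pY2 ?evalE; rewrite /atoms /=; ring.
Qed.

Lemma kerr_scalar_curvature p : D p -> scalar_curvature g p = 0.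
Proof.
move=> Dp; rewrite /scalar_curvature; apply: big1 => l _; apply: big1 => j _.
by rewrite (kerr_ricci 0 hM ha Dp) mxE mulr0.
Qed.

Lemma frame_riemannE p : D p -> frame_components (theta p) (riemann g p) = curv p.
Proof.
by move=> Dp; do 4 (apply/funext => ?); exact: kerr_riemann.
Qed.

Lemma kerr_weyl p : D p -> weyl g p = riemann g p.
Proof.
move=> Dp; apply/funext => k; apply/funext => l; apply/funext => i; apply/funext => j.
by rewrite /weyl kerr_scalar_curvature// (kerr_ricci 0 hM ha Dp) !mxE; ring.
Qed.

Lemma kerr_Amx_block p : D p -> Amx g theta p = ulsubmx (curvature_mx g theta p).
Proof.
move=> Dp; apply/matrixP => i j; rewrite /curvature_mx.
have a12 a b c d := kerr_curvature_anti12 a b c d Dp.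
have a34 a b c d := kerr_curvature_anti34 a b c d Dp.
by rewrite Amx_pair_dual frame_riemannE// self_dual_block.
Qed.

Lemma kerr_Wplus_Amx p : D p -> W p = Amx g theta p.
Proof. by move=> Dp; rewrite /kerr_Wplus /Wplus kerr_weyl// kerr_Amx_block. Qed.

(** Self-dual contraction adds [pA] and [pB]: the diagonal is A + B, A + B, -2 (A + B), and the
    off-diagonal components vanish. *)
Lemma kerr_AmxE p : D p -> Amx g theta p =
  diag_mx (\row_(i < 3) nth 0 [:: - (M / rho alpha p ^+ 3); - (M / rho alpha p ^+ 3);
                                 2 * M / rho alpha p ^+ 3] i).
Proof.
move=> Dp; have a12 a b c d := kerr_curvature_anti12 a b c d Dp.
have a34 a b c d := kerr_curvature_anti34 a b c d Dp.
have AB : ev p pA + ev p pB = - (M / rho alpha p ^+ 3).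
  have := eval_nil3 hM ha conf_const 0 0 0 pA_pB_invrho Dp.
  rewrite evalD (evalD _ pA) (evalM _ pM) (evalM _ _ invrho_poly).
  rewrite (evalM _ invrho_poly) eval_invrho// eval_var => /eqP; rewrite addr_eq0 => /eqP ->.
  by rewrite -exprVn /atoms /=; ring.
have AB2 : 2 * M / rho alpha p ^+ 3 = - (2 * (ev p pA + ev p pB)) by rewrite AB; ring.
apply/matrixP => i j; rewrite Amx_pair_dual frame_riemannE// !mxE AB2 -AB.
case: i => [[|[|[|//]]] ilt]; case: j => [[|[|[|//]]] jlt];
  rewrite /pair_dual /kerr_curvature /at4 /at3 /at2 /= ?evalE -?val_eqE /= ?mulr1n ?mulr0n;
  by field.
Qed.

Lemma kerr_char_poly p : D p -> char_poly (W p) =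
  \prod_(x <- [:: - (M / rho alpha p ^+ 3); - (M / rho alpha p ^+ 3);
                  - (2 * - (M / rho alpha p ^+ 3))]) ('X - x%:P).
Proof.
move=> Dp; rewrite kerr_Wplus_Amx// kerr_AmxE// char_poly_trig ?diag_mx_is_trig//.
rewrite !big_ord_recl big_ord0 !big_cons big_nil !mxE /= !mulr1n.
have -> : - (2 * - (M / rho alpha p ^+ 3)) = 2 * M / rho alpha p ^+ 3 by ring.
by [].
Qed.

Lemma kerr_confE p : D p -> kerr_conf M alpha p =
  (2 * (- (M / rho alpha p ^+ 3)) ^+ 2 + (2 * M / rho alpha p ^+ 3) ^+ 2) `^ (1 / 3).
Proof.
move=> Dp; rewrite /kerr_conf (eigen_norm_prod (kerr_char_poly Dp)).
rewrite !big_cons big_nil.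
rewrite [X in Num.sqrt X](_ : _ = 2 * (- (M / rho alpha p ^+ 3)) ^+ 2
  + (2 * M / rho alpha p ^+ 3) ^+ 2); last by ring.
set x := (X in Num.sqrt X).
have x0 : 0 <= x.
  by apply: addr_ge0; [apply: mulr_ge0 => //; exact: sqr_ge0|exact: sqr_ge0].
by rewrite -powR12_sqrt// -powRrM; congr (_ `^ _); field.
Qed.

Lemma kerr_conf_rho p : D p -> kerr_conf M alpha p = conf_const / rho alpha p ^+ 2.
Proof.
move=> Dp; rewrite kerr_confE//; have r0 := rho_gt0 hM ha Dp.
(* The sum is 6 M^2 / rho^6, written with real powers so that the cube root distributes over the
   factors. *)
have -> : 2 * (- (M / rho alpha p ^+ 3)) ^+ 2 + (2 * M / rho alpha p ^+ 3) ^+ 2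
   = 6 * M `^ 2%:R * ((rho alpha p)^-1 ^+ 2) `^ 3%:R.
  by rewrite !powR_mulrn ?ltW// ?exprn_gt0 ?invr_gt0// -exprM !exprVn; field; rewrite gt_eqF.
rewrite -exprVn; have := sqr_ge0 (rho alpha p)^-1.
move: ((rho alpha p)^-1 ^+ 2) => u u0.
rewrite !powRM ?mulr_ge0 ?powR_ge0// -!powRrM /conf_const.
have -> : 2%:R * (1 / 3) = 2 / 3 :> R by field.
have -> : 3%:R * (1 / 3) = 1 :> R by field.
by rewrite powRr1.
Qed.

Lemma conf_const_gt0 : 0 < conf_const.
Proof. by rewrite mulr_gt0 ?powR_gt0. Qed.

Lemma kerr_conf_gt0 p : D p -> 0 < kerr_conf M alpha p.
Proof.
by move=> Dp; rewrite kerr_conf_rho// divr_gt0 ?conf_const_gt0// exprn_gt0// (rho_gt0 hM ha).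
Qed.

Lemma represents_conf : represents M alpha conf_const (kerr_conf M alpha) conf_poly.
Proof.
move=> q Dq; rewrite kerr_conf_rho// (evalM _ _ invrho_poly) (evalM _ _ invrho_poly) eval_invrho//.
rewrite eval_var /atoms /=.
by rewrite -exprVn; ring.
Qed.

Lemma kerr_riemannian : is_riemannian D g.
Proof.
split.
- by move=> i j; exact: represents_smooth (represents_metric conf_const hM ha i j).
- by move=> p Dp; rewrite (kerr_metric_coframe hM ha Dp) trmx_mul trmxK.
- move=> p v Dp v0; rewrite (kerr_metric_coframe hM ha Dp) mulmxA -mulmxA.
  (* The quadratic form is the sum of the squared frame components w of v, and w = 0 forces v =
     0. *)
  rewrite -[theta p *m v^T]trmxK trmx_mul trmxK mxE.
  set w := v *m _; under eq_bigr do rewrite [w^T _ _]mxE -expr2.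
  rewrite lt_neqAle sumr_ge0 ?andbT; last by move=> *; exact: sqr_ge0.
  apply: contra v0; rewrite eq_sym psumr_eq0; last by move=> *; exact: sqr_ge0.
  move=> /allP w0; have wE : w = 0.
    apply/rowP => k; rewrite [RHS]mxE; have := w0 k (mem_index_enum _).
    by rewrite /= sqrf_eq0 => /eqP.
  have tU : (theta p)^T \in unitmx by rewrite unitmx_tr (kerr_coframe_unit 0 hM ha Dp).
  by rewrite -(mulmxK tU v) -/w wE mul0mx.
Qed.

Lemma J_frame_tr : J_frame^T = - J_frame :> 'M[R]_4.
Proof.
rewrite /J_frame !raddfB/= raddfD/= !trmx_delta.
by move: (delta_mx _ _) (delta_mx _ _) (delta_mx _ _) (delta_mx _ _) => A B C F;
  apply/matrixP => i j; rewrite !mxE; ring.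
Qed.

Lemma J_frame_sqr p : D p -> J_frame *m J_frame = - 1%:M :> 'M[R]_4.
Proof.
move=> Dp; rewrite (J_frame_evmx M alpha 0 p) -(evmx_mul 0 hM ha)// -J_poly_sqr.
apply/matrixP => i j; rewrite !mxE at2_tab -val_eqE.
by case: eqP; rewrite evalE ?rmorphN1 ?oppr0.
Qed.

Lemma kerr_nijenhuis p k i j : D p -> nijenhuis J p k i j = 0.
Proof.
move=> Dp; rewrite -[RHS](eval_nil3 hM ha conf_const k i j nijenhuis_poly_eq0 Dp).
rewrite /nijenhuis_poly eval_psum4; apply: eq_bigr => l _.
have eN (a b c d e f h : spoly) : ev p (a * b - c * d - e * (f - h))%spoly =
    ev p a * ev p b - ev p c * ev p d - ev p e * (ev p f - ev p h) by rewrite !evalE.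
have JE i' j' : J p i' j' = ev p (at2 Jfield_poly i' j') by exact: represents_J.
have dJE l' i' j' : partial l' (fun q => J q i' j') p
    = ev p (pderiv (kerr_d l') (at2 Jfield_poly i' j')).
  exact: (represents_partial hM ha l' (represents_J conf_const hM ha i' j') Dp).
by rewrite eN -!JE -!dJE.
Qed.

Lemma kerr_hermitian : is_hermitian D g J.
Proof.
split.
- exact: kerr_riemannian.
- by move=> i j; exact: represents_smooth (represents_J conf_const hM ha i j).
- move=> p Dp; have tU := kerr_coframe_unit 0 hM ha Dp.
  rewrite /kerr_J /dual_frame !mulmxA -(mulmxA _ (theta p)) mulmxV// mulmx1.
  by rewrite -(mulmxA _ J_frame J_frame) (J_frame_sqr Dp) mulmxN mulmx1 mulNmx mulVmx.
- move=> p Dp; have tU := kerr_coframe_unit 0 hM ha Dp.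
  (* J^T g J is the Kaehler form times J, so only the square of [J_frame] remains. *)
  rewrite -/(kahler_form g J p) (kahler_form_frame 0 hM ha Dp) /kerr_J /dual_frame !mulmxA.
  rewrite -(mulmxA _ (theta p)) mulmxV// mulmx1 J_frame_tr -(mulmxA _ (- J_frame)).
  rewrite mulNmx (J_frame_sqr Dp) opprK mulmx1.
  by rewrite (kerr_metric_coframe hM ha Dp).
- by move=> p Dp k i j; exact: kerr_nijenhuis.
Qed.

Lemma ext_d2_represents (om : pt -> 'M[R]_4) t p (i j k : 'I_4) :
  (forall i j : 'I_4, represents M alpha conf_const (fun q => om q i j) (at2 t i j)) -> D p ->
  ext_d2 om p i j k = ev p (ext_d2_poly t i j k).
Proof.
move=> h Dp.
have dE l' i' j' : partial l' (fun q => om q i' j') p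
    = ev p (pderiv (kerr_d l') (at2 t i' j')).
  exact: (represents_partial hM ha l' (h i' j') Dp).
by rewrite /ext_d2 /ext_d2_poly evalD; congr (_ + _); rewrite ?evalD ?dE.
Qed.

(** J is unchanged and its compatibility with the metric survives a positive rescaling; the new
    content is the closedness of the rescaled form. *)
Lemma kerr_kahler : is_kahler D (fun p => kerr_conf M alpha p *: g p) J.
Proof.
have [[gS gT gP] JS JJ JgJ NJ] := kerr_hermitian.
split; [split|] => //.
- split.
  + move=> i j; apply: (represents_smooth hM ha (K := conf_const)
      (P := (conf_poly * metric_poly i j)%spoly)) => q Dq.
    by rewrite mxE represents_conf// (represents_metric conf_const hM ha)// evalM.
  + by move=> p Dp; rewrite linearZ/= gT.
  + move=> p v Dp v0; rewrite -scalemxAr -scalemxAl mxE mulr_gt0 ?kerr_conf_gt0//.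
    exact: gP.
- by move=> p Dp; rewrite -scalemxAr -scalemxAl JgJ.
- move=> p Dp i j k; rewrite (ext_d2_represents (t := conf_kahler_poly))//.
    exact: (eval_nil3 hM ha conf_const i j k conf_kahler_closed Dp).
  move=> i' j' q Dq; rewrite /kahler_form -scalemxAr mxE at2_tab evalM represents_conf//.
  by congr (_ * _); exact: (represents_kahler_form conf_const hM ha).
Qed.

(** The constant C disappears in the logarithmic derivative. *)
Lemma grad_lee_potential C p i : 0 < C -> D p ->
  grad (lee_potential alpha C) p 0 i = ev p (lee_poly i).
Proof.
move=> C0 Dp; rewrite mxE.
have r0 := rho_gt0 hM ha Dp.
have rE : represents M alpha conf_const (rho alpha) (pr - pa * pc)%spoly.
  by move=> q _; rewrite !evalE /atoms /=.
have dr := represents_differentiable hM ha rE Dp.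
have dCr : differentiable (fun q => C * (rho alpha q * rho alpha q)) p.
  by apply: differentiableM; [exact: differentiable_cst|exact: differentiableM].
have Cr0 : 0 < C * (rho alpha p * rho alpha p) by rewrite !mulr_gt0.
have -> : lee_potential alpha C = fun q => ln (C * (rho alpha q * rho alpha q)).
  by apply/funext => q; rewrite /lee_potential expr2.
rewrite (partial_comp i dCr (is_derive1_ln Cr0)).2 partialM//; last exact: differentiableM.
rewrite partial_cst mul0r add0r partialM// (represents_partial hM ha i rE Dp).
have := eval_nil3 hM ha conf_const i 0 0 lee_poly_rho Dp.
rewrite evalB (evalM _ 2%:P%spoly) eval_const (evalM _ _ invrho_poly) eval_invrho// => /subr0_eq ->.
by move: (ev p _) => d; field; rewrite !gt_eqF.
Qed.

(** Existence is the polynomial identity [lee_eq_poly_eq0]; uniqueness comes from nondegeneracy of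
    the Kaehler form. *)
Lemma kerr_lee_form C p xi : 0 < C -> D p ->
  is_lee_form_at g J p xi <-> xi = grad (lee_potential alpha C) p.
Proof.
move=> C0 Dp.
have lee : is_lee_form_at g J p (grad (lee_potential alpha C) p).
  move=> i j k.
  rewrite (ext_d2_represents _ _ _ (represents_kahler_form conf_const hM ha) Dp).
  apply/subr0_eq; rewrite -[RHS](eval_nil3 hM ha conf_const i j k lee_eq_poly_eq0 Dp).
  rewrite /lee_eq_poly evalB /wedge12 !grad_lee_potential// !evalD !evalM.
  by rewrite !(represents_kahler_form conf_const hM ha).
split=> [h|->//]; have tU := kerr_coframe_unit 0 hM ha Dp.
apply: (@wedge12_inj _ (kahler_form g J p)).
- rewrite (kahler_form_frame 0 hM ha Dp) !unitmx_mul unitmx_tr tU andbT /=.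
  have e : J_frame^T *m J_frame = 1%:M :> 'M[R]_4.
    by rewrite J_frame_tr mulNmx (J_frame_sqr Dp) opprK.
  by have [] := mulmx1_unit e.
- rewrite (kahler_form_frame 0 hM ha Dp) !trmx_mul !trmxK J_frame_tr.
  by rewrite mulmxN mulNmx opprK mulmxA.
- by move=> i j k; rewrite -h lee.
Qed.

Lemma expR_lee_potential C p : 0 < C -> D p ->
  expR (- lee_potential alpha C p) = (C * rho alpha p ^+ 2)^-1.
Proof.
move=> C0 Dp; rewrite expRN lnK// posrE mulr_gt0// exprn_gt0// (rho_gt0 hM ha Dp).
by [].
Qed.

End KerrTheorem.

Theorem mainTheorem3 (R : realType) (M alpha : R) (hM : 0 < M) (ha : 0 < alpha) :
  let D := kerr_domain M alpha in
  let g := kerr_metric M alpha in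
  let theta := kerr_coframe M alpha in
  let J := kerr_J M alpha in
  let W := kerr_Wplus M alpha in
  let lambda := fun p => - (M / rho alpha p ^+ 3) in
  (* the coframe is orthonormal *)
  (forall p, D p -> is_orthonormal_coframe (g p) (theta p)) /\
  (* A is the self-dual block of the curvature, and its explicit value *)
  (forall p, D p ->
     [/\ Amx g theta p = ulsubmx (curvature_mx g theta p),
         Amx g theta p = W p + (scalar_curvature g p / 12)%:M
       & Amx g theta p =
         diag_mx (\row_(i < 3) nth 0 [:: - (M / rho alpha p ^+ 3);
                                         - (M / rho alpha p ^+ 3);
                                         2 * M / rho alpha p ^+ 3] i)]) /\
  (* Ricci-flat, hence Einstein, with A = W^+ <> 0 *)
  (forall p, D p -> ricci g p = 0 /\ scalar_curvature g p = 0) /\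
  is_einstein D g /\
  (forall p, D p -> Amx g theta p = W p /\ W p != 0) /\
  (* eigenvalues (lambda, lambda, - 2 lambda), at most two of them distinct *)
  (forall p, D p ->
     char_poly (W p) =
       \prod_(x <- [:: lambda p; lambda p; - (2 * lambda p)]) ('X - x%:P)) /\
  (forall p, D p -> exists s : seq R,
     (size s <= 2)%N /\ forall x : R, eigenvalue (W p) x -> x \in s) /\
  (* the conformal factor |W^+|^(2/3) *)
  (forall p, D p ->
     kerr_conf M alpha p =
       (2 * (- (M / rho alpha p ^+ 3)) ^+ 2
        + (2 * M / rho alpha p ^+ 3) ^+ 2) `^ (1 / 3) /\
     kerr_conf M alpha p =
       6 `^ (1 / 3) * M `^ (2 / 3) / rho alpha p ^+ 2) /\
  (* it makes the metric Kaehler *)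
  is_hermitian D g J /\
  is_kahler D (fun p => kerr_conf M alpha p *: g p) J /\
  (* the Lee form is exact, and its conformal factor *)
  (forall C : R, 0 < C -> forall p, D p ->
     (forall xi : 'rV[R]_4,
        is_lee_form_at g J p xi <-> xi = grad (lee_potential alpha C) p) /\
     expR (- lee_potential alpha C p) = (C * rho alpha p ^+ 2)^-1) /\
  (* comparison of the two conformal factors *)
  (forall p, D p ->
     expR (- lee_potential alpha 1 p) = 1 / rho alpha p ^+ 2) /\
  (exists c : R, 0 < c /\ forall p, D p ->
     kerr_conf M alpha p = c * expR (- lee_potential alpha 1 p)) /\
  (forall p, D p ->
     kerr_conf M alpha p =
       expR (- lee_potential alpha (6 `^ (- (1 / 3)) * M `^ (- (2 / 3))) p)).
Proof.
move=> D g theta J W lambda.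
have AW p : D p -> Amx g theta p = W p by move=> Dp; rewrite /W kerr_Wplus_Amx.
have W0 p : D p -> W p != 0.
  move=> Dp; rewrite -AW// /g /theta kerr_AmxE//.
  (* The last diagonal entry 2 M / rho^3 is positive. *)
  apply/eqP => /matrixP/(_ ord_max ord_max); rewrite !mxE /= mulr1n => /eqP.
  rewrite gt_eqF//; apply: divr_gt0; first exact: mulr_gt0.
  by apply: exprn_gt0; exact: (rho_gt0 hM ha).
split; first by move=> p Dp; split;
  [exact: (kerr_coframe_unit 0 hM ha Dp)|exact: (kerr_metric_coframe hM ha Dp)].
split.
  move=> p Dp; split; [exact: kerr_Amx_block| |exact: kerr_AmxE].
  rewrite AW// /g kerr_scalar_curvature// mul0r.
  by rewrite (_ : 0%:M = 0) ?addr0//; apply/matrixP => i j; rewrite !mxE mul0rn.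
split; first by move=> p Dp; split; [exact: (kerr_ricci 0 hM ha Dp)|exact: kerr_scalar_curvature].
split; first by exists 0 => p Dp; rewrite scale0r (kerr_ricci 0 hM ha Dp).
split; first by move=> p Dp; split; [exact: AW|exact: W0].
split; first by move=> p Dp; exact: kerr_char_poly.
split.
  move=> p Dp; exists [:: lambda p; - (2 * lambda p)]; split => // x.
  rewrite eigenvalue_root_char /W kerr_char_poly// root_prod_XsubC !inE.
  by move=> /or3P[] ->; rewrite ?orbT.
split; first by move=> p Dp; split; [exact: kerr_confE|exact: kerr_conf_rho].
split; first exact: kerr_hermitian.
split; first exact: kerr_kahler.
split.
  move=> C C0 p Dp; split; first by move=> xi; exact: (kerr_lee_form hM ha xi C0 Dp).
  exact: (expR_lee_potential hM ha C0 Dp).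
split; first by move=> p Dp; rewrite (expR_lee_potential hM ha)// !mul1r.
split.
  exists (conf_const M); split; first exact: conf_const_gt0.
  by move=> p Dp; rewrite (expR_lee_potential hM ha)// mul1r kerr_conf_rho.
(* This C is the inverse of [conf_const], and the conformal factor is (C rho^2)^-1. *)
move=> p Dp; rewrite (expR_lee_potential hM ha)//; last by rewrite mulr_gt0// powR_gt0.
by rewrite kerr_conf_rho// !powRN !invfM !invrK.
Qed.
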